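(* Let $\mathbb{M}$ be either $\mathbb{M}_{\rm LOCC}$ or $\mathbb{M}_{\rm SEP}$ and let $P$ be either $\mathcal{D}_{\rm SEP}$ or $\mathcal{D}_{\rm PPT}$. Then the function $\mathbb{M}E^P_R$, defined on states of finite-dimensional $n$-partite systems, satisfies: (a) faithfulness: $\mathbb{M}E^P_R(\rho)=0$ if and only if $\rho\in P$; (b) convexity: $\mathbb{M}E^P_R(\sum_ip_i\rho_i)\leq\sum_ip_i\mathbb{M}E^P_R(\rho_i)$ for every probability distribution $(p_i)$ and states $\rho_i$; (c) strong LOCC monotonicity: if an LOCC operation applied to $\rho^{in}$ yields outcome $i$ with probability $p^{out}_i$ and post-measurement state $\rho^{out}_i$, then $\mathbb{M}E^P_R(\rho^{in})\geq\sum_ip^{out}_i\mathbb{M}E^P_R(\rho^{out}_i)$; (d) strong superadditivity: for any state $\rho_{XY}$ on $X=A_1\cdots A_n$ and $Y=A'_1\cdots A'_n$, where $\rho_{XY}$ is regarded as an $n$-partite state with parties $A_1A'_1,\ldots,A_nA'_n$, one has $\mathbb{M}E^P_R(\rho_{XY})\geq\mathbb{M}E^P_R(\rho_X)+\mathbb{M}E^P_R(\rho_Y)$, with $\rho_X,\rho_Y$ the reduced states.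
   Context: Systems are $n$-partite with finite-dimensional local spaces $\mathcal{H}_1,\ldots,\mathcal{H}_n$ (local dimensions arbitrary). $S(\rho\|\sigma)={\rm Tr}\rho\log\rho-{\rm Tr}\rho\log\sigma$ ($+\infty$ if ${\rm supp}\,\rho\not\subset{\rm supp}\,\sigma$); for distributions $S((p_i)\|(q_i))=\sum_ip_i\log(p_i/q_i)$. A measurement operation associated with a POVM $(M_i)_i$ is $\mathcal{M}(Z)=\sum_i{\rm Tr}(M_iZ)|i\rangle\langle i|$. $\mathbb{M}_{\rm LOCC}$: POVMs implementable by local operations and classical communication among the $n$ parties. $\mathbb{M}_{\rm SEP}$: POVMs with $M_i=\sum_kM^{(1)}_{i,k}\otimes\cdots\otimes M^{(n)}_{i,k}$, $M^{(j)}_{i,k}\geq0$. $\mathcal{D}_{\rm SEP}$: fully separable states $\sum_ip_i\sigma_i^{(1)}\otimes\cdots\otimes\sigma_i^{(n)}$; $\mathcal{D}_{\rm PPT}$: states whose partial transpose with respect to every bipartition of the parties is positive semidefinite. $\mathbb{M}E^P_R(\rho)=\inf_{\sigma\in P}\sup_{\mathcal{M}\in\mathbb{M}}S(\mathcal{M}(\rho)\|\mathcal{M}(\sigma))$. *)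

(* Defs.v *)
From mathcomp Require Import all_boot all_order all_algebra.
From mathcomp Require Import all_classical all_reals all_analysis.
From mathcomp Require Import complex.

Set Implicit Arguments.
Unset Strict Implicit.
Unset Printing Implicit Defensive.

Import Order.TTheory GRing.Theory Num.Theory.
Local Open Scope ring_scope.

Section Finite_dim_QM.
Variable R : realType.
Local Notation C := (R[i]).

(* Operators on the Hilbert space C^T (T a finite index set = basis). *)
Definition op (T : finType) := T -> T -> C.

Definition opmul (T : finType) (A B : op T) : op T :=
  fun x y => \sum_(z : T) A x z * B z y.
Definition tr (T : finType) (A : op T) : C := \sum_(x : T) A x x.
Definition idop (T : finType) : op T := fun x y => (x == y)%:R.
(* positive semidefinite: <v, A v> >= 0 for every vector v (order of C:
   real and nonnegative) *)
Definition psd (T : finType) (A : op T) : Prop :=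
  forall v : T -> C, 0 <= \sum_(x : T) \sum_(y : T) (v x)^* * A x y * v y.
Definition is_state (T : finType) (rho : op T) : Prop :=
  psd rho /\ tr rho = 1.

Definition cmap (T T' : finType) := op T -> op T'.
Definition is_cp (T T' : finType) (E : cmap T T') : Prop :=
  exists (m : nat) (K : 'I_m -> T' -> T -> C),
    forall X, E X = fun x' y' =>
      \sum_(k < m) \sum_(x : T) \sum_(y : T) K k x' x * X x y * (K k y' y)^*.
Definition is_instrument (T T' O : finType) (E : O -> cmap T T') : Prop :=
  (forall o, is_cp (E o)) /\ (forall X, \sum_(o : O) tr (E o X) = tr X).
Definition is_povm (T O : finType) (M : O -> op T) : Prop :=
  (forall o, psd (M o)) /\ (fun x y => \sum_(o : O) M o x y) = @idop T.

Definition meas (T O : finType) (M : O -> op T) (rho : op T) : O -> R :=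
  fun o => complex.Re (tr (opmul (M o) rho)).
Definition relent (O : finType) (p q : O -> R) : \bar R :=
  if [exists o, (0 < p o) && (q o == 0)] then +oo%E
  else (\sum_(o : O | 0 < p o) p o * ln (p o / q o))%:E.

Variable n : nat.

Definition sys (H : 'I_n -> finType) : finType := {dffun forall j : 'I_n, H j}.

Definition tens (H : 'I_n -> finType) (A : forall j, op (H j)) : op (sys H) :=
  fun x y => \prod_(j < n) A j (x j) (y j).

Definition munit (T : finType) (a b : T) : op T :=
  fun x y => ((x == a) && (y == b))%:R.

(* tensor product of local linear maps (defined on matrix units, extended
   linearly) *)
Definition tmap (H H' : 'I_n -> finType) (E : forall j, cmap (H j) (H' j))
  : cmap (sys H) (sys H') :=
  fun X x' y' => \sum_(x : sys H) \sum_(y : sys H) X x y *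
     \prod_(j < n) E j (munit (x j) (y j)) (x' j) (y' j).

Definition fully_separable (H : 'I_n -> finType) (rho : op (sys H)) : Prop :=
  exists (m : nat) (p : 'I_m -> R) (s : 'I_m -> forall j, op (H j)),
    (forall i, 0 <= p i) /\ \sum_(i < m) p i = 1 /\
    (forall i j, is_state (s i j)) /\
    rho = fun x y => \sum_(i < m) ((p i)%:C)%C * tens (s i) x y.

Definition mixsys (H : 'I_n -> finType) (S : {set 'I_n}) (a b : sys H) : sys H :=
  [ffun j => if j \in S then a j else b j].
Definition ptrans (H : 'I_n -> finType) (S : {set 'I_n}) (rho : op (sys H))
  : op (sys H) :=
  fun x y => rho (mixsys S y x) (mixsys S x y).
Definition ppt_state (H : 'I_n -> finType) (rho : op (sys H)) : Prop :=
  is_state rho /\ forall S : {set 'I_n}, psd (ptrans S rho).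

(* finite-round LOCC instruments: rounds of local instruments (outcomes
   broadcast), later rounds chosen depending on earlier outcomes,
   and classical coarse-graining of outcomes. *)
Inductive LOCC : forall (H H' : 'I_n -> finType) (O : finType),
    (O -> cmap (sys H) (sys H')) -> Prop :=
| LOCC_local (H H' : 'I_n -> finType) (Oj : 'I_n -> finType)
    (L : forall j, Oj j -> cmap (H j) (H' j)) :
    (forall j, is_instrument (L j)) ->
    LOCC (O := {dffun forall j : 'I_n, Oj j})
         (fun o => tmap (fun j => L j (o j)))
| LOCC_seq (H G H' : 'I_n -> finType) (O1 O2 : finType)
    (F : O1 -> cmap (sys H) (sys G)) (E : O1 -> O2 -> cmap (sys G) (sys H')) :
    LOCC F -> (forall o1, LOCC (E o1)) ->
    LOCC (O := (O1 * O2)%type) (fun o X => E o.1 o.2 (F o.1 X))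
| LOCC_coarse (H H' : 'I_n -> finType) (O O' : finType)
    (E : O -> cmap (sys H) (sys H')) (f : O -> O') :
    LOCC E ->
    LOCC (fun o' X => fun x y => \sum_(o : O | f o == o') E o X x y).

Definition locc_povm (H : 'I_n -> finType) (O : finType) (M : O -> op (sys H))
  : Prop :=
  is_povm M /\ exists (H' : 'I_n -> finType) (E : O -> cmap (sys H) (sys H')),
    LOCC E /\ forall o X, tr (E o X) = tr (opmul (M o) X).
Definition sep_povm (H : 'I_n -> finType) (O : finType) (M : O -> op (sys H))
  : Prop :=
  is_povm M /\ forall o, exists (m : nat) (A : 'I_m -> forall j, op (H j)),
    (forall k j, psd (A k j)) /\ M o = fun x y => \sum_(k < m) tens (A k) x y.

Variant mclass := M_LOCC | M_SEP.
Variant pclass := P_SEP | P_PPT.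

Definition in_M (mc : mclass) (H : 'I_n -> finType) (O : finType)
  (M : O -> op (sys H)) : Prop :=
  match mc with M_LOCC => locc_povm M | M_SEP => sep_povm M end.
Definition in_P (pc : pclass) (H : 'I_n -> finType) (rho : op (sys H)) : Prop :=
  match pc with P_SEP => fully_separable rho | P_PPT => ppt_state rho end.

Definition MER (mc : mclass) (pc : pclass) (H : 'I_n -> finType)
  (rho : op (sys H)) : \bar R :=
  ereal_inf [set v | exists sigma : op (sys H), in_P pc sigma /\
    v = ereal_sup [set w | exists (O : finType) (M : O -> op (sys H)),
                     in_M mc M /\ w = relent (meas M rho) (meas M sigma)]].

Definition jointH (H1 H2 : 'I_n -> finType) : 'I_n -> finType :=
  fun j => (H1 j * H2 j)%type.
Definition pairsys (H1 H2 : 'I_n -> finType) (x : sys H1) (y : sys H2)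
  : sys (jointH H1 H2) := [ffun j => (x j, y j)].
Definition redX (H1 H2 : 'I_n -> finType) (rho : op (sys (jointH H1 H2)))
  : op (sys H1) :=
  fun x x' => \sum_(y : sys H2) rho (pairsys x y) (pairsys x' y).
Definition redY (H1 H2 : 'I_n -> finType) (rho : op (sys (jointH H1 H2)))
  : op (sys H2) :=
  fun y y' => \sum_(x : sys H1) rho (pairsys x y) (pairsys x y').

End Finite_dim_QM.

(* Main.v *)
Require Import Defs.
From mathcomp Require Import all_boot all_order all_algebra.
From mathcomp Require Import all_classical all_reals all_analysis.
From mathcomp Require Import complex.
From mathcomp Require Import ring lra.
Import Order.TTheory GRing.Theory Num.Theory.
Local Open Scope ring_scope.
Set Implicit Arguments.
Unset Strict Implicit.
Unset Printing Implicit Defensive.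

(* A measured relative entropy over separable measurements can be handled with
   product Kraus operators only: an LOCC instrument is a separable instrument, it
   preserves the cones of unnormalised separable and PPT states, and its adjoint
   maps separable POVM elements to separable ones. Measuring after an instrument
   [F] is therefore a measurement of the same class before it, and the chain rule
     S(P || Q) = S(p || q) + sum_o p_o S(P_o || Q_o)
   for the joint outcome distribution gives strong monotonicity when [S(p || q)]
   is dropped. For superadditivity, [F] measures [X] and keeps [Y]; joint convexity
   merges the conditional terms into [S(M(rho_Y) || M(sigma'))], where
   [sigma' = sum_o (p_o / q_o) F_o(sigma)] is again a free state on [Y]. Since the
   bound holds for every measurement on [X], no minimax theorem is needed.
   Convexity is joint convexity of the classical relative entropy. For
   faithfulness, a product informationally complete measurement and a Hellinger
   lower bound turn vanishing relative entropy into entrywise convergence, and the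
   free states are closed (for separable states by Caratheodory and compactness). *)

(** The two measurement classes and the two sets of free states are treated together, through a
    short interface. A class contains the informationally complete measurement, is closed under
    coarse-graining, and lets measurements be pulled back along its own instruments ([inst_measure],
    [inst_cond_map]). The free states are the trace-one elements of a cone, so normalisation is
    postponed and outcomes of probability zero need care only where a conditional state is formed.
    An outcome with [p_o > 0 = q_o] makes the supremum over measurements infinite and is split off
    before [p_o / q_o] is formed. Inequalities between finite sums of suprema or infima are reduced
    to inequalities valid for every simultaneous choice of elements. *)

Lemma dep_choice (I : Type) (T : I -> Type) (P : forall i, T i -> Prop) :
  (forall i, exists t, P i t) -> exists f, forall i, P i (f i).
Proof. by move=> h; exists (fun i => projT1 (cid (h i))) => i; case: cid. Qed.

(** * Products of sums over dependent families *)

Section Distr.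
Variables (S : comPzSemiRingType) (I : finType) (T : I -> finType).

(** [bigA_distr_big_dep] ranges over functions into the tagged sum of the [T i]; those that respect
    the tags correspond to dependent functions through [fprod_of_dffun]. Every passage between
    products of local sums and sums over [sys H] rests on this. *)
Lemma prod_sum_dffun (F : forall i, T i -> S) :
  \prod_i \sum_(t : T i) F i t
    = \sum_(f : {dffun forall i, T i}) \prod_i F i (f i).
Proof.
under eq_bigr => i _ do rewrite (big_tag (fun i => F i) i).
rewrite bigA_distr_big_dep.
pose G i : {ffun T i -> S} := [ffun t => F i t].
transitivity (\sum_(g in family (tagged_with T)) \prod_i untag 0 (G i) (g i)).
  apply: eq_bigr => g _; apply: eq_bigr => i _.
  by rewrite /untag; case: eqP => // e; rewrite ffunE.
rewrite -(big_fprod 1 +%R G) (reindex (@fprod_of_dffun I T)); last first.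
  exact/onW_bij/fprod_of_dffun_bij.
apply: eq_bigr => f _; apply: eq_bigr => i _.
by rewrite ffunE /fprod_of_dffun fprodE.
Qed.
End Distr.

(** * Cones *)

Section Cone.
Variables (V : zmodType).

(** Finite sums of generators, without scalar factors, so that the same notion serves operators and
    maps; proofs remove one generator at a time. *)
Inductive cone (G : V -> Prop) : V -> Prop :=
| cone0 : cone G 0
| coneD g v : G g -> cone G v -> cone G (g + v).

Lemma cone_gen (G : V -> Prop) g : G g -> cone G g.
Proof. by move=> Gg; rewrite -[g]addr0; apply: coneD => //; apply: cone0. Qed.

Lemma cone_add G u v : cone G u -> cone G v -> cone G (u + v).
Proof.
move=> Gu Gv; elim: Gu => [|g w Gg _ IH]; first by rewrite add0r.
by rewrite -addrA; apply: coneD.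
Qed.

Lemma cone_sum G (I : Type) (r : seq I) (P : pred I) (F : I -> V) :
  (forall i, P i -> cone G (F i)) -> cone G (\sum_(i <- r | P i) F i).
Proof.
by move=> GF; elim/big_ind: _ => //; [exact: cone0|exact: cone_add].
Qed.

Lemma cone_finite G v : cone G v ->
  exists (m : nat) (g : 'I_m -> V), (forall i, G (g i)) /\ v = \sum_i g i.
Proof.
elim=> [|g w Gg _ [m [h [Gh ->]]]].
  by exists 0%N, (fun=> 0); split; [case|rewrite big_ord0].
exists m.+1, (fun i => oapp h g (unlift ord0 i)); split.
  by move=> i; case: (unlift ord0 i).
rewrite big_ord_recl unlift_none; congr (_ + _).
by apply: eq_bigr => i _; rewrite liftK.
Qed.
End Cone.

Lemma cone_map (U V : zmodType) (G : U -> Prop) (G' : V -> Prop) (f : U -> V) :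
  f 0 = 0 -> {morph f : x y / x + y} ->
  (forall g, G g -> cone G' (f g)) -> forall v, cone G v -> cone G' (f v).
Proof.
move=> f0 fD fG v; elim=> [|g w Gg _ IH]; first by rewrite f0; exact: cone0.
by rewrite fD; apply: cone_add => //; apply: fG.
Qed.

Lemma cone_sub (V : zmodType) (G G' : V -> Prop) v :
  (forall g, G g -> cone G' g) -> cone G v -> cone G' v.
Proof. by move=> GG'; apply: (cone_map (f := id)). Qed.

(** * Positive semidefinite operators *)

Section Psd.
Variable R : realType.
Local Notation C := (R[i]).
Variable T : finType.
Implicit Types (A B : op R T) (u v w : T -> C).

Definition bform A u v : C := \sum_x \sum_y (u x)^* * A x y * v y.

Lemma bformDl A u v w : bform A (fun x => u x + v x) w = bform A u w + bform A v w.
Proof.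
rewrite /bform -big_split; apply: eq_bigr => x _; rewrite -big_split /=.
by apply: eq_bigr => y _; rewrite rmorphD /= !mulrDl.
Qed.

Lemma bformDr A u v w : bform A u (fun x => v x + w x) = bform A u v + bform A u w.
Proof.
rewrite /bform -big_split; apply: eq_bigr => x _; rewrite -big_split /=.
by apply: eq_bigr => y _; rewrite mulrDr.
Qed.

Lemma bformZl A c u v : bform A (fun x => c * u x) v = c^* * bform A u v.
Proof.
rewrite /bform mulr_sumr; apply: eq_bigr => x _; rewrite mulr_sumr.
by apply: eq_bigr => y _; rewrite rmorphM /= !mulrA.
Qed.

Lemma bformZr A c u v : bform A u (fun x => c * v x) = c * bform A u v.
Proof.
rewrite /bform mulr_sumr; apply: eq_bigr => x _; rewrite mulr_sumr.
by apply: eq_bigr => y _; rewrite mulrCA.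
Qed.

Lemma bform_add A B u v : bform (A + B) u v = bform A u v + bform B u v.
Proof.
rewrite /bform -big_split; apply: eq_bigr => x _; rewrite -big_split /=.
by apply: eq_bigr => y _; rewrite mulrDr mulrDl.
Qed.

Definition ebasis x : T -> C := fun y => (y == x)%:R.

Lemma sum_ebasis x (F : T -> C) : \sum_y (y == x)%:R * F y = F x.
Proof.
rewrite (bigD1 x) //= eqxx mul1r big1 ?addr0 // => y /negPf ->.
by rewrite mul0r.
Qed.

Lemma bform_ebasisl A x v : bform A (ebasis x) v = \sum_y A x y * v y.
Proof.
rewrite /bform -[RHS](sum_ebasis x (fun z => \sum_y A z y * v y)).
apply: eq_bigr => z _; rewrite mulr_sumr; apply: eq_bigr => y _.
by rewrite /ebasis conjC_nat mulrA.
Qed.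

Lemma bform_ebasis A x y : bform A (ebasis x) (ebasis y) = A x y.
Proof.
rewrite bform_ebasisl -[RHS](sum_ebasis y (A x)).
by apply: eq_bigr => z _; rewrite mulrC.
Qed.

Lemma bform_line A u v t :
  bform A (fun x => u x + t * v x) (fun x => u x + t * v x) =
  bform A u u + t * bform A u v + t^* * bform A v u + t^* * t * bform A v v.
Proof. by rewrite bformDl !bformDr !bformZl !bformZr; ring. Qed.

(** Hermiticity by polarisation: the form is real at [u + t * v], and [t = 1] and [t = 'i] together
    determine the off-diagonal values. *)
Lemma psd_bform_conj A u v : psd A -> (bform A u v)^* = bform A v u.
Proof.
move=> pA; set a := bform A u v; set b := bform A v u.
have real t : (t * a + t^* * b)^* = t * a + t^* * b.
  have := bform_line A u v t.
  have /conj_Creal h1 := ger0_real (pA (fun x => u x + t * v x)).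
  have /conj_Creal h2 := ger0_real (pA u).
  have /conj_Creal h3 := ger0_real (pA v).
  rewrite -/a -/b => e.
  have -> : t * a + t^* * b =
    bform A (fun x => u x + t * v x) (fun x => u x + t * v x)
    - bform A u u - t^* * t * bform A v v by rewrite e; ring.
  by rewrite !rmorphB !rmorphM /= conjCK h1 h2 h3 (mulrC t).
have := real 1; have := real 'i.
rewrite !rmorphD !rmorphM /= !conjCK !conjCi !rmorph1 !mul1r => e1 e2.
have e3 : a^* - b^* = b - a.
  have i0 : ('i : C) != 0 by exact: neq0Ci.
  apply: (mulfI i0); apply: oppr_inj; rewrite -!mulNr !mulrBr.
  by move: e1; rewrite !mulNr opprK => ->; ring.
have : 2 * a^* = 2 * b.
  have -> : 2 * a^* = (a^* + b^*) + (a^* - b^*) by ring.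
  by rewrite e2 e3; ring.
by move/mulfI; apply; rewrite pnatr_eq0.
Qed.

Lemma psd_herm A x y : psd A -> (A x y)^* = A y x.
Proof. by move=> /psd_bform_conj h; rewrite -bform_ebasis h bform_ebasis. Qed.

Lemma psd_diag_ge0 A x : psd A -> 0 <= A x x.
Proof. by move=> pA; rewrite -bform_ebasis; apply: pA. Qed.

Lemma psd_diag0 A x y : psd A -> A x x = 0 -> A x y = 0.
Proof.
move=> pA Axx; apply/eqP/negPn/negP => Axy.
have c_gt0 : 0 < A x y * (A x y)^* by rewrite mul_conjC_gt0.
(* With this [s] the form at [e_y + s * A x y * e_x] is [A y y + 2 * s * |A x y|^2 = -1], which
   contradicts positivity. *)
pose s := - (A y y + 1) / (2 * (A x y * (A x y)^*)).
have sC : s^* = s.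
  apply/conj_Creal/rpred_div.
    by rewrite rpredN rpredD ?rpred1 // ger0_real // psd_diag_ge0.
  by rewrite rpredM ?rpred_nat // gtr0_real.
have := pA (fun z => ebasis y z + s * A x y * ebasis x z).
rewrite -/(bform _ _ _) bform_line !bform_ebasis -(psd_herm x y pA) Axx mulr0 addr0.
rewrite rmorphM /= sC (_ : _ + _ = -1) ?oppr_ge0 ?ler10 //.
by rewrite /s; field; rewrite conjC_eq0 Axy.
Qed.

Definition ketbra (a : T -> C) : op R T := fun x y => a x * (a y)^*.

Lemma bform_ketbra a u v :
  bform (ketbra a) u v = (\sum_x (u x)^* * a x) * (\sum_y (a y)^* * v y).
Proof.
rewrite big_distrl; apply: eq_bigr => x _; rewrite big_distrr /=.
by apply: eq_bigr => y _; rewrite /ketbra !mulrA.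
Qed.

Definition rank1 A := exists a, A = ketbra a.

(** Cholesky elimination, by induction on the number of nonzero diagonal entries: a pivot [x] is
    cleared by subtracting [ketbra a], where [a] is column [x] of [A] divided by [sqrtC (A x x)]. *)
Lemma psd_cone_rank1 A : psd A -> cone rank1 A.
Proof.
move: {2}#|_| (leqnn #|[pred x | A x x != 0]|) => n.
elim: n A => [|n IH] A.
  rewrite leqn0 => /eqP cA pA.
  suff -> : A = 0 by exact: cone0.
  apply/funext => x; apply/funext => y; apply: psd_diag0 => //.
  have /negbT := card0_eq cA x; rewrite inE negbK => /eqP //.
move=> cA pA.
have [x /= Axx|A0] := pickP [pred x | A x x != 0]; last first.
  by apply: IH => //; rewrite (eq_card0 A0).
pose d := A x x.
have d_ge0 : 0 <= d := psd_diag_ge0 x pA.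
pose a y := A y x / sqrtC d.
have cs : (sqrtC d)^* = sqrtC d by rewrite conj_Creal // ger0_real // sqrtC_ge0.
have ss : sqrtC d * sqrtC d = d by rewrite -expr2 sqrtCK.
have aE y z : ketbra a y z = A y x * A x z / d.
  by rewrite /ketbra /a rmorphM /= fmorphV /= cs psd_herm // mulrACA -invfM ss.
have -> : A = ketbra a + (A - ketbra a) by rewrite addrC subrK.
apply: coneD; first by exists a.
have A'E y : (A - ketbra a) y y = A y y - A y x * A x y / d by rewrite -aE.
apply: IH.
  rewrite -ltnS; apply: leq_trans cA; apply: proper_card; apply/fintype.properP; split.
    apply/fintype.subsetP => y; rewrite !inE A'E; apply: contraNN => /eqP Ayy.
    by rewrite Ayy (psd_diag0 _ pA Ayy) !mul0r subr0.
  by exists x; rewrite inE // A'E mulfK // subrr eqxx.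
move=> v; rewrite -/(bform _ _ _).
pose w := bform A (ebasis x) v.
(* Completing the square: the form of the remainder at [v] is the form of [A] at
   [v - (w / d) * e_x]. *)
have := pA (fun z => v z + (- w / d) * ebasis x z); rewrite -/(bform _ _ _).
have wc : bform A v (ebasis x) = w^* by rewrite psd_bform_conj.
have dc : d^* = d by rewrite conj_Creal // ger0_real.
rewrite bform_line bform_ebasis wc -/w -/d => h.
suff <- : bform A v v + - w / d * w^* + (- w / d)^* * w + (- w / d)^* * (- w / d) * d
   = bform (A - ketbra a) v v by [].
have -> : bform (A - ketbra a) v v = bform A v v - bform (ketbra a) v v.
  apply/eqP; rewrite -subr_eq0 opprB addrA subr_eq0 eq_sym -bform_add.
  by rewrite subrK.
have aw : \sum_y (a y)^* * v y = w / sqrtC d.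
  rewrite /w bform_ebasisl mulr_suml; apply: eq_bigr => y _.
  by rewrite /a rmorphM /= fmorphV /= cs psd_herm // mulrAC.
have -> : bform (ketbra a) v v = w^* * w / d.
  rewrite bform_ketbra aw.
  have -> : \sum_x0 (v x0)^* * a x0 = (w / sqrtC d)^*.
    by rewrite -aw rmorph_sum /=; apply: eq_bigr => y _; rewrite rmorphM /= conjCK mulrC.
  by rewrite rmorphM /= fmorphV /= cs mulrACA -invfM ss.
by rewrite !(rmorphM, rmorphN) /= fmorphV /= dc; field.
Qed.

Lemma cone_psd (G : op R T -> Prop) A :
  (forall B, G B -> psd B) -> cone G A -> psd A.
Proof.
move=> GP; elim=> [v|B D GB _ IH v].
  by rewrite big1 // => x _; rewrite big1 // => y _; rewrite mulr0 mul0r.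
by rewrite -/(bform _ _ _) bform_add; apply: addr_ge0; [apply: GP|apply: IH].
Qed.

Lemma psd0 : psd (0 : op R T).
Proof. by apply: (@cone_psd (fun=> False)) => //; exact: cone0. Qed.

Lemma psd_ketbra a : psd (ketbra a).
Proof.
move=> v; rewrite -/(bform _ _ _) bform_ketbra.
have -> : \sum_x (v x)^* * a x = (\sum_y (a y)^* * v y)^*.
  rewrite rmorph_sum; apply: eq_bigr => y _.
  by rewrite rmorphM /= conjCK mulrC.
by rewrite mulrC mul_conjC_ge0.
Qed.

Lemma psd_add A B : psd A -> psd B -> psd (A + B).
Proof. by move=> pA pB v; rewrite -/(bform _ _ _) bform_add addr_ge0 ?pA ?pB. Qed.

Lemma psd_sum (I : Type) (r : seq I) (P : pred I) (F : I -> op R T) :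
  (forall i, P i -> psd (F i)) -> psd (\sum_(i <- r | P i) F i).
Proof.
by move=> pF; elim/big_ind: _ => //; [exact: psd0|exact: psd_add].
Qed.

Lemma bform_scale A c u v : bform (fun x y => c * A x y) u v = c * bform A u v.
Proof.
rewrite /bform mulr_sumr; apply: eq_bigr => x _; rewrite mulr_sumr.
by apply: eq_bigr => y _; rewrite mulrA [_ * c]mulrC -!mulrA.
Qed.

Lemma psd_scale A c : 0 <= c -> psd A -> psd (fun x y => c * A x y).
Proof. by move=> c0 pA v; rewrite -/(bform _ _ _) bform_scale mulr_ge0 ?pA. Qed.

Lemma tr_ge0 A : psd A -> 0 <= tr A.
Proof. by move=> pA; apply: sumr_ge0 => x _; apply: psd_diag_ge0. Qed.

Lemma tr_opmulDl A B D : tr (opmul (A + B) D) = tr (opmul A D) + tr (opmul B D).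
Proof.
rewrite /tr /opmul -big_split; apply: eq_bigr => x _; rewrite -big_split /=.
by apply: eq_bigr => z _; rewrite mulrDl.
Qed.

Lemma tr_opmul_ketbra a B : tr (opmul (ketbra a) B) = bform B a a.
Proof.
rewrite /tr /opmul /bform exchange_big; apply: eq_bigr => x _.
by apply: eq_bigr => y _; rewrite /ketbra; ring.
Qed.

Lemma tr_opmul_ge0 A B : psd A -> psd B -> 0 <= tr (opmul A B).
Proof.
move=> /psd_cone_rank1 cA pB; elim: cA => [|_ D [a ->] _ IH].
  by rewrite /tr big1 // => x _; rewrite /opmul big1 // => z _; rewrite mul0r.
by rewrite tr_opmulDl addr_ge0 // tr_opmul_ketbra; apply: pB.
Qed.

Lemma psd_tr0 A : psd A -> tr A = 0 -> A = 0.
Proof.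
move=> pA /eqP; rewrite psumr_eq0 => [/allP h|x _]; last exact: psd_diag_ge0.
apply/funext => x; apply/funext => y; apply: psd_diag0 => //.
by apply/eqP/h; rewrite mem_index_enum.
Qed.
End Psd.

(** * Separable maps *)

Section Sandwich.
Variable R : realType.
Local Notation C := (R[i]).

Definition sandwich (T T' : finType) (k : T' -> T -> C) : cmap R T T' :=
  fun X x' y' => \sum_x \sum_y k x' x * X x y * (k y' y)^*.

Lemma sandwich0 (T T' : finType) (k : T' -> T -> C) : sandwich k 0 = 0.
Proof.
apply/funext => x'; apply/funext => y'; rewrite /sandwich big1 // => x _.
by rewrite big1 // => y _; rewrite mulr0 mul0r.
Qed.

Lemma sandwichD (T T' : finType) (k : T' -> T -> C) : {morph sandwich k : X Y / X + Y}.
Proof.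
move=> X Y; apply/funext => x'; apply/funext => y'.
rewrite /sandwich -[RHS]big_split; apply: eq_bigr => x _; rewrite -big_split /=.
by apply: eq_bigr => y _; rewrite mulrDr mulrDl.
Qed.

Lemma sandwichZ (T T' : finType) (k : T' -> T -> C) c (X : op R T) :
  sandwich k (fun x y => c * X x y) = fun x y => c * sandwich k X x y.
Proof.
apply/funext => x'; apply/funext => y'; rewrite /sandwich mulr_sumr.
apply: eq_bigr => x _; rewrite mulr_sumr; apply: eq_bigr => y _.
by rewrite mulrCA -!mulrA.
Qed.

Lemma sandwich_munit (T T' : finType) (k : T' -> T -> C) a b x' y' :
  sandwich k (@munit R T a b) x' y' = k x' a * (k y' b)^*.
Proof.
rewrite /sandwich -[RHS](sum_ebasis a (fun x => k x' x * (k y' b)^*)).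
apply: eq_bigr => x _.
rewrite -[in RHS](sum_ebasis b (fun y => k x' x * (k y' y)^*)) mulr_sumr.
apply: eq_bigr => y _; rewrite /munit -mulnb natrM; ring.
Qed.

Lemma sandwich_comp (T T1 T' : finType) (k2 : T' -> T1 -> C) (k1 : T1 -> T -> C)
    (X : op R T) :
  sandwich k2 (sandwich k1 X) = sandwich (fun x' x => \sum_z k2 x' z * k1 z x) X.
Proof.
apply/funext => x'; apply/funext => y'; rewrite /sandwich.
transitivity (\sum_z \sum_w \sum_x \sum_y
    (k2 x' z * k1 z x) * X x y * (k2 y' w * k1 w y)^*).
  apply: eq_bigr => z _; apply: eq_bigr => w _.
  rewrite mulr_sumr mulr_suml; apply: eq_bigr => x _.
  rewrite mulr_sumr mulr_suml; apply: eq_bigr => y _.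
  by rewrite rmorphM /=; ring.
under eq_bigr => z _ do rewrite exchange_big /=.
rewrite exchange_big /=; apply: eq_bigr => x _.
under eq_bigr => z _ do rewrite exchange_big /=.
rewrite exchange_big /=; apply: eq_bigr => y _.
rewrite big_distrl big_distrl /=; apply: eq_bigr => z _.
by rewrite rmorph_sum mulr_sumr.
Qed.

Lemma psd_sandwich (T T' : finType) (k : T' -> T -> C) (X : op R T) :
  psd X -> psd (sandwich k X).
Proof.
move=> pX v; have := pX (fun x => \sum_x' (k x' x)^* * v x').
congr (0 <= _).
transitivity (\sum_x \sum_y \sum_x' \sum_y'
    (v x')^* * (k x' x * X x y * (k y' y)^*) * v y').
  apply: eq_bigr => x _; apply: eq_bigr => y _.
  rewrite rmorph_sum !mulr_suml; apply: eq_bigr => x' _.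
  rewrite mulr_sumr; apply: eq_bigr => y' _.
  by rewrite rmorphM /= conjCK; ring.
under eq_bigr => x _ do rewrite exchange_big /=.
rewrite exchange_big /=; apply: eq_bigr => x' _.
under eq_bigr => x _ do rewrite exchange_big /=.
rewrite exchange_big /=; apply: eq_bigr => y' _.
rewrite /sandwich mulr_sumr mulr_suml; apply: eq_bigr => x _.
by rewrite mulr_sumr mulr_suml.
Qed.

Lemma tr_opmul_sandwich (T T' : finType) (k : T' -> T -> C) (M : op R T')
    (X : op R T) :
  tr (opmul M (sandwich k X)) = tr (opmul (sandwich (fun x x' => (k x' x)^*) M) X).
Proof.
rewrite /tr /opmul /sandwich.
transitivity (\sum_y' \sum_x' \sum_x \sum_y
    M y' x' * (k x' x * X x y * (k y' y)^*)).
  apply: eq_bigr => y' _; apply: eq_bigr => x' _; rewrite mulr_sumr.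
  by apply: eq_bigr => x _; rewrite mulr_sumr.
under eq_bigr => y' _ do rewrite exchange_big /=.
rewrite exchange_big [RHS]exchange_big /=; apply: eq_bigr => x _.
under eq_bigr => y' _ do rewrite exchange_big /=.
rewrite exchange_big; apply: eq_bigr => y _ /=.
rewrite mulr_suml; apply: eq_bigr => y' _.
rewrite mulr_suml; apply: eq_bigr => x' _.
by rewrite conjCK; ring.
Qed.

Lemma opmul_idl (T : finType) (X : op R T) : opmul (@idop R T) X = X.
Proof.
apply/funext => x; apply/funext => y; rewrite /opmul.
rewrite -[RHS](sum_ebasis x (fun z => X z y)); apply: eq_bigr => z _.
by rewrite /idop eq_sym.
Qed.

Lemma tr_opmul_munit (T : finType) (A : op R T) x y :
  tr (opmul A (@munit R T x y)) = A y x.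
Proof.
rewrite /tr /opmul -[RHS](sum_ebasis y (fun w => A w x)); apply: eq_bigr => w _.
rewrite -[A w x](sum_ebasis x (fun z => A w z)) mulr_sumr.
by apply: eq_bigr => z _; rewrite /munit -mulnb natrM; ring.
Qed.

Lemma tr_opmul_inj (T : finType) (A B : op R T) :
  (forall X, tr (opmul A X) = tr (opmul B X)) -> A = B.
Proof.
move=> AB; apply/funext => x; apply/funext => y.
by rewrite -!tr_opmul_munit AB.
Qed.
End Sandwich.

(** * Product Kraus operators and separable instruments *)

Section Separable.
Variables (R : realType) (n : nat).
Local Notation C := (R[i]).
Implicit Types H G : 'I_n -> finType.

Lemma prod_eq_sys H (x y : sys H) :
  \prod_(j < n) ((x j == y j)%:R : C) = (x == y)%:R.
Proof.
have [->|xy] := eqVneq x y; first by rewrite big1 // => j _; rewrite eqxx.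
have [j xyj] : exists j, x j != y j.
  apply/existsP; move: xy; apply: contraNT; rewrite negb_exists => /forallP h.
  by apply/eqP/ffunP => j; apply/eqP; move: (h j); rewrite negbK.
by rewrite (bigD1 j) //= (negPf xyj) mul0r.
Qed.

Lemma tens_sum H (K : 'I_n -> finType) (B : forall j, K j -> op R (H j)) :
  tens (fun j => \sum_(k : K j) B j k)
    = \sum_(f : {dffun forall j, K j}) tens (fun j => B j (f j)).
Proof.
apply/funext => x; apply/funext => y; rewrite !fct_sumE.
rewrite -(prod_sum_dffun (fun j k => B j k (x j) (y j))).
by apply: eq_bigr => j _; rewrite !fct_sumE.
Qed.

Definition ptens H (a : forall j, H j -> C) : sys H -> C :=
  fun x => \prod_(j < n) a j (x j).

Lemma tens_ketbra H (a : forall j, H j -> C) :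
  tens (fun j => ketbra (a j)) = ketbra (ptens a).
Proof.
apply/funext => x; apply/funext => y.
by rewrite /ketbra /ptens rmorph_prod -big_split.
Qed.

Definition sepgen H (A : op R (sys H)) :=
  exists B : forall j, op R (H j), (forall j, psd (B j)) /\ A = tens B.

Definition prodgen H (A : op R (sys H)) :=
  exists a : forall j, H j -> C, A = tens (fun j => ketbra (a j)).

(** Each local factor is a sum of rank-one operators and [tens] is multilinear. The number of terms
    varies with the party, hence the tagged families picked by [dep_choice]. *)
Lemma sepgen_prodgen H (A : op R (sys H)) : sepgen A -> cone (@prodgen H) A.
Proof.
move=> [B [pB ->]].
have h j : exists mg : {m : nat & 'I_m -> H j -> C},
    B j = \sum_(k < tag mg) ketbra (tagged mg k).
  have [m [g [gr Bg]]] := cone_finite (psd_cone_rank1 (pB j)).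
  have [f fP] := choice gr.
  by exists (Tagged (fun m => 'I_m -> H j -> C) f); rewrite Bg; exact: eq_bigr.
have [mg Bmg] := dep_choice h.
rewrite (_ : tens B = tens (fun j => \sum_(k < tag (mg j)) ketbra (tagged (mg j) k))).
  by rewrite tens_sum; apply: cone_sum => f _; apply: cone_gen; eexists.
by apply/funext => x; apply/funext => y; apply: eq_bigr => j _; rewrite Bmg.
Qed.

Lemma psd_tens H (B : forall j, op R (H j)) :
  (forall j, psd (B j)) -> psd (tens B).
Proof.
move=> pB; apply: (@cone_psd _ _ (@prodgen H)).
  by move=> _ [a ->]; rewrite tens_ketbra; apply: psd_ketbra.
by apply: sepgen_prodgen; exists B.
Qed.

Definition kraus H G (K : forall j, G j -> H j -> C) : cmap R (sys H) (sys G) :=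
  sandwich (fun (x' : sys G) (x : sys H) => \prod_(j < n) K j (x' j) (x j)).

Lemma kraus_tens H G (K : forall j, G j -> H j -> C) (B : forall j, op R (H j)) :
  kraus K (tens B) = tens (fun j => sandwich (K j) (B j)).
Proof.
apply/funext => x'; apply/funext => y'; rewrite /tens /sandwich prod_sum_dffun.
apply: eq_bigr => x _; rewrite prod_sum_dffun; apply: eq_bigr => y _.
by rewrite rmorph_prod -!big_split.
Qed.

Definition sepmap H G (E : cmap R (sys H) (sys G)) :=
  cone (fun E' : cmap R (sys H) (sys G) => exists K, E' = kraus K) E.

Lemma sepmap0 H G (E : cmap R (sys H) (sys G)) : sepmap E -> E 0 = 0.
Proof.
elim=> [//|_ E' [K ->] _ IH]; rewrite /GRing.add /= IH.
by rewrite /kraus sandwich0; exact: addr0.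
Qed.

Lemma sepmapD H G (E : cmap R (sys H) (sys G)) :
  sepmap E -> {morph E : X Y / X + Y}.
Proof.
elim=> [X Y|_ E' [K ->] _ IH X Y].
  by rewrite [RHS]addr0.
change (kraus K (X + Y) + E' (X + Y) = (kraus K X + E' X) + (kraus K Y + E' Y)).
by rewrite /kraus sandwichD IH addrACA.
Qed.

(** The Heisenberg picture: the conjugate transpose of a product Kraus operator is again a
    product. *)
Lemma sepmap_adjoint H G (E : cmap R (sys H) (sys G)) : sepmap E ->
  exists F : cmap R (sys G) (sys H), sepmap F /\
    forall M X, tr (opmul M (E X)) = tr (opmul (F M) X).
Proof.
elim=> [|_ E' [K ->] _ [F [sF FP]]].
  exists 0; split; first exact: cone0.
  move=> M X; rewrite /tr !big1 // => x _; rewrite /opmul big1 // => z _.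
    by rewrite mul0r.
  by rewrite mulr0.
exists (kraus (fun j x x' => (K j x' x)^*) + F); split.
  by apply: coneD => //; eexists.
move=> M X; change (tr (opmul M (kraus K X + E' X)) =
  tr (opmul (kraus (fun j x x' => (K j x' x)^*) M + F M) X)).
rewrite tr_opmulDl -FP /kraus.
have -> : (fun (x' : sys H) (x : sys G) => \prod_(j < n) (K j (x j) (x' j))^*)
  = fun x x' => (\prod_(j < n) K j (x' j) (x j))^*.
  by apply/funext => x; apply/funext => y; rewrite rmorph_prod.
rewrite -tr_opmul_sandwich /tr /opmul -big_split; apply: eq_bigr => x _.
by rewrite -big_split; apply: eq_bigr => z _; exact: mulrDr.
Qed.

Lemma sepmap_psd H G (E : cmap R (sys H) (sys G)) X :
  sepmap E -> psd X -> psd (E X).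
Proof.
move=> sE pX; elim: sE => [|_ E' [K ->] _ IH]; first exact: psd0.
by apply: psd_add => //; apply: psd_sandwich.
Qed.

Lemma sepmap_sep1 H G (E : cmap R (sys H) (sys G)) X :
  sepmap E -> cone (@sepgen H) X -> cone (@sepgen G) (E X).
Proof.
move=> sE cX; elim: sE => [|_ E' [K ->] _ IH]; first exact: cone0.
apply: cone_add => //; apply: cone_map cX; rewrite /kraus.
- exact: sandwich0.
- exact: sandwichD.
- move=> _ [B [pB ->]]; apply: cone_gen; rewrite -/(kraus _) kraus_tens.
  by eexists; split; last by []; move=> j; apply: psd_sandwich.
Qed.

Lemma sepmap_comp H G G' (E : cmap R (sys H) (sys G)) (F : cmap R (sys G) (sys G')) :
  sepmap F -> sepmap E -> sepmap (fun X => F (E X)).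
Proof.
move=> sF; elim=> [|_ E' [K ->] _ IH].
  by rewrite (_ : (fun X => _) = 0); [exact: cone0|
    apply/funext => X; exact: sepmap0].
have -> : (fun X => F (kraus K X + E' X)) =
    (fun X => F (kraus K X)) + (fun X => F (E' X)).
  by apply/funext => X; rewrite sepmapD.
apply: cone_add => // {IH}; elim: sF => [|_ F' [L ->] _ IH]; first exact: cone0.
apply: coneD => //; exists (fun j x' x => \sum_z L j x' z * K j z x).
apply/funext => X; rewrite /kraus sandwich_comp; congr (sandwich _ X).
apply/funext => x'; apply/funext => x; rewrite prod_sum_dffun.
by apply: eq_bigr => z _; rewrite big_split.
Qed.

Definition sepinst H G (O : finType) (E : O -> cmap R (sys H) (sys G)) :=
  (forall o, sepmap (E o)) /\ (forall X, \sum_o tr (E o X) = tr X).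

(** On a matrix unit each local map is a sum over its Kraus operators; expanding the product over
    parties gives one product Kraus operator for every family of local Kraus indices. *)
Lemma sepmap_tmap H G (E : forall j, cmap R (H j) (G j)) :
  (forall j, is_cp (E j)) -> sepmap (tmap E).
Proof.
move=> cpE.
have h j : exists mK : {m : nat & 'I_m -> G j -> H j -> C}, forall X,
    E j X = fun x' y' => \sum_(k < tag mK) sandwich (tagged mK k) X x' y'.
  have [m [K EK]] := cpE j.
  by exists (Tagged (fun m => 'I_m -> G j -> H j -> C) K).
have [mK mKP] := dep_choice h.
have -> : tmap E = \sum_(f : {dffun forall j, 'I_(tag (mK j))})
    kraus (fun j => tagged (mK j) (f j)).
  apply/funext => X; apply/funext => x'; apply/funext => y'.
  rewrite !fct_sumE /tmap /kraus /sandwich [RHS]exchange_big; apply: eq_bigr => x _.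
  rewrite [RHS]exchange_big; apply: eq_bigr => y _ /=.
  under eq_bigr => j _.
    rewrite mKP; under eq_bigr => k _ do rewrite sandwich_munit; over.
  rewrite prod_sum_dffun mulr_sumr; apply: eq_bigr => f _.
  by rewrite rmorph_prod big_split /=; ring.
by apply: cone_sum => f _; apply: cone_gen; eexists.
Qed.

Lemma LOCC_sepinst H G (O : finType) (E : O -> cmap R (sys H) (sys G)) :
  LOCC E -> sepinst E.
Proof.
elim=> [H1 G1 Oj L iL|H1 G1 H' O1 O2 F E1 _ [sF tF] _ sE|H1 G1 O1 O' E1 f _ [sE tE]].
- split=> [a|X]; first by apply: sepmap_tmap => j; have [] := iL j.
  rewrite /tr /tmap.
  (* Trace preservation is reduced to matrix units, where the sums over outcomes and over the output
     basis factorise into local traces, each a Kronecker delta. *)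
  transitivity (\sum_x \sum_y X x y * (y == x)%:R).
    transitivity (\sum_(o : {dffun forall j, Oj j}) \sum_(z : sys G1) \sum_x \sum_y
       X x y * \prod_(j < n) L j (o j) (munit R (x j) (y j)) (z j) (z j)).
      by apply: eq_bigr => o _; apply: eq_bigr.
    under eq_bigr => o _ do rewrite exchange_big /=.
    rewrite exchange_big; apply: eq_bigr => x _ /=.
    under eq_bigr => o _ do rewrite exchange_big /=.
    rewrite exchange_big; apply: eq_bigr => y _ /=.
    under eq_bigr => o _ do rewrite -mulr_sumr
      -(prod_sum_dffun (fun j z => L j (o j) (munit R (x j) (y j)) z z)).
    rewrite -mulr_sumr -(prod_sum_dffun (fun j o => tr (L j o (munit R (x j) (y j))))).
    congr (_ * _); rewrite -prod_eq_sys; apply: eq_bigr => j _.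
    have [_ ->] := iL j; rewrite /tr /munit.
    rewrite -(sum_ebasis (x j) (fun z => (y j == z)%:R)); apply: eq_bigr => z _.
    by rewrite -mulnb natrM [y j == z]eq_sym.
  by apply: eq_bigr => x _; rewrite -(sum_ebasis x (X x)); apply: eq_bigr => y _; rewrite mulrC.
- split=> [a|X]; first by apply: sepmap_comp; have [] := sE a.1.
  rewrite -(pair_big predT predT (fun o1 o2 => tr (E1 o1 o2 (F o1 X)))) /=.
  by rewrite -tF; apply: eq_bigr => o _; have [_ ->] := sE o.
- split=> [ o'|X].
    have -> : (fun X x y => \sum_(o | f o == o') E1 o X x y) = \sum_(o | f o == o') E1 o.
      by apply/funext => X; apply/funext => x; apply/funext => y; rewrite !fct_sumE.
    by apply: cone_sum => o _; exact: sE.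
  rewrite -tE (partition_big f predT) //=; apply: eq_bigr => o' _.
  by rewrite /tr exchange_big.
Qed.
End Separable.

(** * Free states *)

Section FreeCone.
Variables (R : realType) (n : nat).
Local Notation C := (R[i]).
Implicit Types H G : 'I_n -> finType.

(* For [n = 0] every [tens B] equals 1, so a scalar factor is needed to obtain
   all unnormalised separable states. *)
Definition scaled_sepgen H (A : op R (sys H)) :=
  exists (c : R) (B : forall j, op R (H j)),
    [/\ 0 <= c, forall j, psd (B j) & A = fun x y => (c%:C)%C * tens B x y].

(** Unnormalised free states. In the PPT case the empty [S] contributes positivity of [A] itself. *)
Definition Pcone (pc : pclass) H (A : op R (sys H)) : Prop :=
  match pc with
  | P_SEP => cone (@scaled_sepgen H) A
  | P_PPT => forall S, psd (ptrans S A)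
  end.

Lemma ptrans0 H (A : op R (sys H)) : ptrans finset.set0 A = A.
Proof.
have m0 (a b : sys H) : mixsys finset.set0 a b = b.
  by apply/ffunP => j; rewrite ffunE inE.
by apply/funext => x; apply/funext => y; rewrite /ptrans !m0.
Qed.

Lemma Pcone_psd pc H (A : op R (sys H)) : Pcone pc A -> psd A.
Proof.
case: pc => [cA|/(_ finset.set0)]; last by rewrite ptrans0.
apply: cone_psd cA => _ [c [B [c0 pB ->]]].
by apply: psd_scale; rewrite ?ler0c //; apply: psd_tens.
Qed.

Lemma Pcone0 pc H : Pcone pc (0 : op R (sys H)).
Proof. by case: pc => [|S]; [exact: cone0|exact: psd0]. Qed.

Lemma Pcone_add pc H (A B : op R (sys H)) :
  Pcone pc A -> Pcone pc B -> Pcone pc (A + B).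
Proof.
case: pc => [|pA pB S]; first exact: cone_add.
exact: psd_add (pA S) (pB S).
Qed.

Lemma Pcone_sum pc H (I : Type) (r : seq I) (P : pred I) (F : I -> op R (sys H)) :
  (forall i, P i -> Pcone pc (F i)) -> Pcone pc (\sum_(i <- r | P i) F i).
Proof.
by move=> PF; elim/big_ind: _ => //; [exact: Pcone0|move=> ? ?; exact: Pcone_add].
Qed.

Lemma Pcone_scale pc H (c : R) (A : op R (sys H)) :
  0 <= c -> Pcone pc A -> Pcone pc (fun x y => (c%:C)%C * A x y).
Proof.
move=> c0; case: pc => [cA|pA S]; last by apply: psd_scale (pA S); rewrite ler0c.
apply: (@cone_map _ _ _ _ (fun A x y => (c%:C)%C * A x y)) cA.
- by apply/funext => x; apply/funext => y; rewrite mulr0.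
- by move=> X Y; apply/funext => x; apply/funext => y; exact: mulrDr.
- move=> _ [d [B [d0 pB ->]]]; apply: cone_gen; exists (c * d), B.
  split=> //; first exact: mulr_ge0.
  by apply/funext => x; apply/funext => y; rewrite rmorphM mulrA.
Qed.

(** Partial transposition passes through a product Kraus operator at the price of conjugating its
    factors in [S]. The factors stay a product, so separable maps preserve the PPT cone. *)
Lemma ptrans_kraus H G (K : forall j, G j -> H j -> C) S (X : op R (sys H)) :
  ptrans S (kraus K X)
    = kraus (fun j x' x => if j \in S then (K j x' x)^* else K j x' x) (ptrans S X).
Proof.
apply/funext => x'; apply/funext => y'; rewrite /ptrans /kraus /sandwich.
rewrite !pair_bigA /=.
(* Exchanging the [S]-components of the row and column indices is an involution on the pairs summed
   over. *)
pose sw (z : sys H * sys H) := (mixsys S z.2 z.1, mixsys S z.1 z.2).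
have swK : involutive sw.
  move=> [x y]; rewrite /sw /=.
  by congr pair; apply/ffunP => j; rewrite !ffunE; case: ifP => ->.
rewrite (reindex_inj (inv_inj swK)); apply: eq_bigr => -[x y] _ /=.
rewrite ![_ * X _ _]mulrC -!mulrA; congr (_ * _).
rewrite !rmorph_prod -!big_split; apply: eq_bigr => j _ /=; rewrite !ffunE.
by case: ifP => // _; rewrite conjCK mulrC.
Qed.

Lemma Pcone_sepmap pc H G (E : cmap R (sys H) (sys G)) X :
  sepmap E -> Pcone pc X -> Pcone pc (E X).
Proof.
move=> sE PX; elim: sE => [|_ E' [K ->] _ IH]; first exact: Pcone0.
apply: Pcone_add => // {IH}; case: pc PX => [cX|pX S]; last first.
  by rewrite ptrans_kraus; apply: psd_sandwich.
apply: cone_map cX; rewrite /kraus.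
- exact: sandwich0.
- exact: sandwichD.
- move=> _ [c [B [c0 pB ->]]]; apply: cone_gen.
  exists c, (fun j => sandwich (K j) (B j)); split=> // [j|].
    exact: psd_sandwich.
  by rewrite sandwichZ -/(kraus _) kraus_tens.
Qed.

Lemma tr_tens H (B : forall j, op R (H j)) : tr (tens B) = \prod_(j < n) tr (B j).
Proof. by rewrite /tr (prod_sum_dffun (fun j x => B j x x)). Qed.

Lemma tr_sys_inhabited (T : finType) (A : op R T) : tr A = 1 -> inhabited T.
Proof.
have [x _|T0] := pickP (@predT T); first by [].
by move=> /eqP; rewrite /tr big_pred0 // eq_sym oner_eq0.
Qed.

Lemma ge0_ReK (z : C) : 0 <= z -> ((complex.Re z)%:C)%C = z.
Proof. by move=> /ger0_real/RRe_real. Qed.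

Lemma tr_ebasis (T : finType) (x : T) : tr (ketbra (@ebasis R T x)) = 1.
Proof.
rewrite /tr /ketbra /ebasis -[RHS](sum_ebasis x (fun=> 1)).
apply: eq_bigr => y _; rewrite conjC_nat mulr1 -natrM mulnb.
by rewrite andbb.
Qed.

Lemma fully_separable_cone H (A : op R (sys H)) :
  fully_separable A <-> cone (@scaled_sepgen H) A /\ tr A = 1.
Proof.
split=> [[m [p [s [p0 [p1 [st ->]]]]]]|[cA trA]].
  split.
    have -> : (fun x y => \sum_(i < m) ((p i)%:C)%C * tens (s i) x y) =
      \sum_(i < m) (fun x y => ((p i)%:C)%C * tens (s i) x y).
      by apply/funext => x; apply/funext => y; rewrite !fct_sumE.
    apply: cone_sum => i _; apply: cone_gen; exists (p i), (s i); split=> // j.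
    by have [] := st i j.
  rewrite /tr exchange_big /=.
  under eq_bigr => i _.
    rewrite -mulr_sumr -/(tr _) tr_tens big1 => [|j _]; last by have [] := st i j.
    rewrite mulr1; over.
  by rewrite -rmorph_sum p1.
(* Trace one excludes an empty basis. The point [x0] supplies a default pure state for local factors
   of trace zero, which are themselves zero. *)
have [x0] := tr_sys_inhabited trA.
have [m [g [gG Ag]]] := cone_finite cA.
have [cB cBP] := @dep_choice _ (fun=> (R * (forall j, op R (H j)))%type)
  (fun i cB => [/\ 0 <= cB.1, forall j, psd (cB.2 j) &
     g i = fun x y => (cB.1%:C)%C * tens cB.2 x y])
  (fun i => let: ex_intro c (ex_intro B h) := gG i in ex_intro _ (c, B) h).
pose t i j := complex.Re (tr ((cB i).2 j)).
have tE i j : ((t i j)%:C)%C = tr ((cB i).2 j).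
  by apply: ge0_ReK; apply: tr_ge0; have [] := cBP i.
have t0 i j : 0 <= t i j by rewrite -ler0c tE; apply: tr_ge0; have [] := cBP i.
pose s i j : op R (H j) := if t i j == 0 then ketbra (ebasis R (x0 j))
  else fun x y => (((t i j)^-1)%:C)%C * (cB i).2 j x y.
have sE i j : (cB i).2 j = fun x y => ((t i j)%:C)%C * s i j x y.
  apply/funext => x; apply/funext => y; rewrite /s; case: eqP => [tij|/eqP tij].
    rewrite (_ : (cB i).2 j = 0) ?tij ?mul0r //.
    by apply: psd_tr0; [have [] := cBP i|rewrite -tE tij].
  by rewrite mulrA -rmorphM mulfV // mul1r.
have sS i j : is_state (s i j).
  rewrite /s; case: eqP => [_|/eqP tij].
    by split; [exact: psd_ketbra|exact: tr_ebasis].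
  split; first by apply: psd_scale; [rewrite ler0c invr_ge0|have [] := cBP i].
  by rewrite /tr -mulr_sumr -/(tr _) -tE -rmorphM mulVf.
(* The weight collects the scalar factor and the traces removed by normalising the local factors. *)
pose p i := (cB i).1 * \prod_(j < n) t i j.
have gE i : g i = fun x y => ((p i)%:C)%C * tens (s i) x y.
  have [_ _ ->] := cBP i; apply/funext => x; apply/funext => y.
  rewrite /p rmorphM rmorph_prod -mulrA -big_split; congr (_ * _).
  by apply: eq_bigr => j _; rewrite [in LHS]sE.
have AE : A = fun x y => \sum_(i < m) ((p i)%:C)%C * tens (s i) x y.
  rewrite Ag; apply/funext => x; apply/funext => y; rewrite !fct_sumE.
  by apply: eq_bigr => i _; rewrite gE.
exists m, p, s; split; last split; last by split.
  by move=> i; rewrite mulr_ge0 ?prodr_ge0 //; have [] := cBP i.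
have : tr A = ((\sum_(i < m) p i)%:C)%C.
  rewrite AE /tr exchange_big rmorph_sum; apply: eq_bigr => i _ /=.
  rewrite -mulr_sumr -/(tr _) tr_tens big1 ?mulr1 // => j _.
  by have [] := sS i j.
by rewrite trA => -[].
Qed.

Lemma in_P_cone pc H (A : op R (sys H)) : in_P pc A <-> Pcone pc A /\ tr A = 1.
Proof.
case: pc; first exact: fully_separable_cone.
split=> [[[_ trA] pA]|[pA trA]] //; split=> //; split=> //.
exact: (@Pcone_psd P_PPT).
Qed.
End FreeCone.

(** * LOCC and separable instruments *)

Section LocalMaps.
Variable R : realType.
Local Notation C := (R[i]).

Lemma is_cp_sum (T T' I : finType) (K : I -> T' -> T -> C) (E : cmap R T T') :
  (forall X, E X = fun x y => \sum_i sandwich (K i) X x y) -> is_cp E.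
Proof.
move=> EK; exists #|I|, (fun k => K (enum_val k)) => X; rewrite EK.
apply/funext => x; apply/funext => y.
by rewrite (big_enum_val (A := I) (fun i => sandwich (K i) X x y)).
Qed.

Lemma is_cpZ (T T' : finType) (E : cmap R T T') c X : is_cp E ->
  E (fun x y => c * X x y) = fun x y => c * E X x y.
Proof.
move=> [m [K EK]]; rewrite !EK; apply/funext => x; apply/funext => y.
rewrite mulr_sumr; apply: eq_bigr => k _.
by have := congr1 (fun F : op R T' => F x y) (sandwichZ (K k) c X).
Qed.

Lemma sum_pair (T U : finType) (F : T * U -> C) :
  \sum_p F p = \sum_a \sum_b F (a, b).
Proof. by rewrite pair_bigA; apply: eq_bigr => -[]. Qed.

Lemma sum_pair_ebasis (T U : finType) (b : U) (F : T * U -> C) :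
  \sum_p (p.2 == b)%:R * F p = \sum_a F (a, b).
Proof.
by rewrite sum_pair; apply: eq_bigr => a _; rewrite (sum_ebasis b (fun c => F (a, c))).
Qed.

Definition ltrace (T : finType) : cmap R T unit := fun X _ _ => tr X.

Lemma is_cp_ltrace (T : finType) : is_cp (@ltrace T).
Proof.
apply: (is_cp_sum (K := fun (t : T) (_ : unit) x => (x == t)%:R)) => X.
apply/funext => x; apply/funext => y; rewrite /ltrace /tr; apply: eq_bigr => t _.
rewrite /sandwich -[LHS](sum_ebasis t (fun a => X a t)); apply: eq_bigr => a _.
rewrite -[X a t](sum_ebasis t (X a)) mulr_sumr; apply: eq_bigr => b _.
by rewrite conjC_nat; ring.
Qed.

Definition lptrace (T U : finType) : cmap R (T * U)%type U :=
  fun X b d => \sum_a X (a, b) (a, d).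

Lemma is_cp_lptrace (T U : finType) : is_cp (@lptrace T U).
Proof.
apply: (is_cp_sum (K := fun (t : T) b (x : T * U) => (x == (t, b))%:R)) => X.
apply/funext => b; apply/funext => d; rewrite /lptrace; apply: eq_bigr => t _.
rewrite /sandwich -[LHS](sum_ebasis (t, b) (fun x => X x (t, d))).
apply: eq_bigr => x _.
rewrite -[X x (t, d)](sum_ebasis (t, d) (X x)) mulr_sumr; apply: eq_bigr => y _.
by rewrite conjC_nat; ring.
Qed.

(** The map [E (x) id] on a pair of systems held by one party. *)
Definition lext (T T' U : finType) (E : cmap R T T')
    : cmap R (T * U)%type (T' * U)%type :=
  fun X p q => E (fun a c => X (a, p.2) (c, q.2)) p.1 q.1.

Lemma is_cp_lext (T T' U : finType) (E : cmap R T T') :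
  is_cp E -> is_cp (@lext T T' U E).
Proof.
move=> [m [K EK]].
exists m, (fun k (p : T' * U) (x : T * U) => (x.2 == p.2)%:R * K k p.1 x.1) => X.
apply/funext => p; apply/funext => q; rewrite /lext EK; apply: eq_bigr => k _.
transitivity (\sum_(x : T * U) (x.2 == p.2)%:R * \sum_(y : T * U) (y.2 == q.2)%:R *
   (K k p.1 x.1 * X x y * (K k q.1 y.1)^*)).
  rewrite sum_pair_ebasis; apply: eq_bigr => a _.
  by rewrite sum_pair_ebasis; apply: eq_bigr.
apply: eq_bigr => x _; rewrite mulr_sumr; apply: eq_bigr => y _.
by rewrite rmorphM /= conjC_nat; ring.
Qed.

Lemma tr_lext (T T' U : finType) (E : cmap R T T') X :
  tr (@lext T T' U E X) = \sum_u tr (E (fun a c => X (a, u) (c, u))).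
Proof.
rewrite /tr exchange_big.
by rewrite sum_pair.
Qed.

Lemma is_instrument_lext (T T' U O : finType) (E : O -> cmap R T T') :
  is_instrument E -> is_instrument (fun o => @lext T T' U (E o)).
Proof.
move=> [cE tE]; split=> [a|X]; first exact: is_cp_lext.
under eq_bigr => o _ do rewrite tr_lext.
rewrite exchange_big; under eq_bigr => u _ do rewrite tE.
by rewrite /tr exchange_big sum_pair.
Qed.
End LocalMaps.

(** * Measurement classes, their instruments, and conditioning on a subsystem *)

Section Locc.
Variables (R : realType) (n : nat).
Local Notation C := (R[i]).
Implicit Types H G : 'I_n -> finType.

Lemma LOCC_local1 H G (L : forall j, cmap R (H j) (G j)) :
  (forall j, is_cp (L j)) -> (forall j X, tr (L j X) = tr X) ->
  LOCC (fun _ : unit => tmap L).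
Proof.
move=> cL tL.
have lL : forall j, is_instrument (fun _ : unit => L j).
  by move=> j; split=> // X; rewrite big_const card_unit /= addr0.
(* The local round announces a family of [tt], one per party; coarse-graining turns this one-element
   type into [unit]. *)
have := LOCC_coarse (fun=> tt) (LOCC_local lL).
congr LOCC; apply/funext => u; apply/funext => X; apply/funext => x; apply/funext => y.
rewrite (big_pred1 [ffun=> tt]) // => f; rewrite /= unitE eqxx; apply/esym/eqP/ffunP => j.
by rewrite ffunE; case: (f j).
Qed.

Lemma LOCC_post H G G' (O : finType) (E : O -> cmap R (sys H) (sys G))
    (F : cmap R (sys G) (sys G')) :
  LOCC E -> LOCC (fun _ : unit => F) -> LOCC (fun o X => F (E o X)).
Proof.
move=> lE lF.
have := LOCC_coarse fst (LOCC_seq lE (E := fun _ _ => F) (fun=> lF)).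
congr LOCC; apply/funext => o; apply/funext => X; apply/funext => x; apply/funext => y.
by rewrite (big_pred1 (o, tt)) // => -[a []]; rewrite /= xpair_eqE andbT.
Qed.

Definition unitH : 'I_n -> finType := fun=> unit.

(** The output systems of a protocol depend on the measurement, whereas [LOCC_seq] wants one output
    for all branches. Tracing the outputs down to the trivial system gives a common one. *)
Lemma locc_povm_unit H (O : finType) (M : O -> op R (sys H)) : locc_povm M ->
  exists E : O -> cmap R (sys H) (sys unitH),
    LOCC E /\ forall o X, tr (E o X) = tr (opmul (M o) X).
Proof.
move=> [_ [H' [E [lE EM]]]].
have lT : LOCC (fun _ : unit => tmap (fun j => @ltrace R (H' j))).
  apply: LOCC_local1 => [j|j X]; first exact: is_cp_ltrace.
  by rewrite /ltrace {1}/tr big_const card_unit /= addr0.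
exists (fun o X => tmap (fun j => @ltrace R (H' j)) (E o X)); split.
  exact: (LOCC_post lE lT).
move=> o X; rewrite -EM; have [_ <-] := LOCC_sepinst lT.
by rewrite big_const card_unit /= addr0.
Qed.

Lemma sep_povm_cone H (O : finType) (M : O -> op R (sys H)) :
  sep_povm M <-> is_povm M /\ forall o, cone (@sepgen R n H) (M o).
Proof.
split=> -[pM sM]; split=> // o.
  have [m [A [pA ->]]] := sM o.
  rewrite (_ : (fun x y => _) = \sum_(k < m) tens (A k)).
    by apply: cone_sum => k _; apply: cone_gen; exists (A k).
  by apply/funext => x; apply/funext => y; rewrite !fct_sumE.
have [m [g [gG ->]]] := cone_finite (sM o).
have [A AP] := choice gG.
exists m, A; split=> [k j|]; first by have [] := AP k.
apply/funext => x; apply/funext => y; rewrite !fct_sumE.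
by apply: eq_bigr => k _; have [_ ->] := AP k.
Qed.

Lemma in_M_povm mc H (O : finType) (M : O -> op R (sys H)) : in_M mc M -> is_povm M.
Proof. by case: mc => -[]. Qed.

Lemma tr_opmul_suml (T : finType) (I : Type) (r : seq I) (P : pred I)
    (M : I -> op R T) X :
  tr (opmul (fun x y => \sum_(i <- r | P i) M i x y) X)
    = \sum_(i <- r | P i) tr (opmul (M i) X).
Proof.
rewrite /tr /opmul [RHS]exchange_big; apply: eq_bigr => x _.
by rewrite [RHS]exchange_big; apply: eq_bigr => z _; rewrite mulr_suml.
Qed.

(** Also of use along an injective [f], where it only pads a measurement with zero effects;
    measurements with different outcome types are thereby brought to a common one. *)
Lemma in_M_coarse mc H (O O' : finType) (f : O -> O') (M : O -> op R (sys H)) :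
  in_M mc M -> in_M mc (fun o' x y => \sum_(o | f o == o') M o x y).
Proof.
have sumE (o' : O') : (fun x y => \sum_(o | f o == o') M o x y) = \sum_(o | f o == o') M o.
  by apply/funext => x; apply/funext => y; rewrite !fct_sumE.
move=> MM; have [pM iM] := in_M_povm MM.
have pM' : is_povm (fun o' x y => \sum_(o | f o == o') M o x y).
  split=> [a|]; first by rewrite sumE; apply: psd_sum => o _; exact: pM.
  rewrite -iM; apply/funext => x; apply/funext => y.
  by rewrite [RHS](partition_big f predT).
case: mc MM => [[_ [H' [E [lE EM]]]]|/sep_povm_cone[_ cM]].
  split=> //; exists H', (fun o' X x y => \sum_(o | f o == o') E o X x y); split.
    exact: LOCC_coarse.
  move=> o' X; rewrite tr_opmul_suml -(eq_bigr _ (fun o _ => EM o X)).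
  by rewrite /tr exchange_big.
by apply/sep_povm_cone; split=> // o'; rewrite sumE; apply: cone_sum.
Qed.

(** For each measurement class, instruments that may precede a measurement without leaving the
    class. *)
Definition inst (mc : mclass) H G (O : finType) (F : O -> cmap R (sys H) (sys G)) :=
  match mc with M_LOCC => LOCC F | M_SEP => sepinst F end.

Lemma inst_sepinst mc H G (O : finType) (F : O -> cmap R (sys H) (sys G)) :
  inst mc F -> sepinst F.
Proof. by case: mc => //; exact: LOCC_sepinst. Qed.

(** The effect for [(o, i)] is the adjoint of [F o] applied to [M o i]. The second measurement may
    depend on the outcome of the first; monotonicity needs this adaptivity. *)
Lemma inst_measure mc H G (O O2 : finType) (F : O -> cmap R (sys H) (sys G))
    (M : O -> O2 -> op R (sys G)) :
  inst mc F -> (forall o, in_M mc (M o)) ->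
  exists N : O * O2 -> op R (sys H), in_M mc N /\
    forall o i X, tr (opmul (N (o, i)) X) = tr (opmul (M o i) (F o X)).
Proof.
move=> iF MM; have [sF tF] := inst_sepinst iF.
have [Fa FaP] := choice (fun o => sepmap_adjoint (sF o)).
pose N p := Fa p.1 (M p.1 p.2).
have NE o i X : tr (opmul (N (o, i)) X) = tr (opmul (M o i) (F o X)).
  by rewrite (FaP o).2.
have pN : is_povm N.
  split=> [[a i]|]; first by apply: sepmap_psd (FaP a).1 _; have [] := in_M_povm (MM a).
  (* Completeness is tested against every [X], where it becomes trace preservation of [F]. *)
  apply: tr_opmul_inj => X; rewrite tr_opmul_suml opmul_idl -tF.
  rewrite sum_pair.
  apply: eq_bigr => o _; under eq_bigr => i _ do rewrite NE.
  by rewrite -tr_opmul_suml (in_M_povm (MM o)).2 opmul_idl.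
exists N; split=> //; case: mc iF MM => iF MM.
  have [E EP] := choice (fun o => locc_povm_unit (MM o)).
  split=> //; exists unitH, (fun p X => E p.1 p.2 (F p.1 X)); split.
    exact: (LOCC_seq iF (fun o => (EP o).1)).
  by move=> [a i] X; rewrite NE (EP a).2.
apply/sep_povm_cone; split=> // -[a i]; apply: sepmap_sep1 (FaP a).1 _.
by have /sep_povm_cone[_] := MM a.
Qed.

Definition pfst H1 H2 (z : sys (jointH H1 H2)) : sys H1 := [ffun j => (z j).1].
Definition psnd H1 H2 (z : sys (jointH H1 H2)) : sys H2 := [ffun j => (z j).2].

Lemma pfstK H1 H2 (x : sys H1) (y : sys H2) : pfst (pairsys x y) = x.
Proof. by apply/ffunP => j; rewrite !ffunE. Qed.

Lemma psndK H1 H2 (x : sys H1) (y : sys H2) : psnd (pairsys x y) = y.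
Proof. by apply/ffunP => j; rewrite !ffunE. Qed.

Lemma pairsysK H1 H2 (z : sys (jointH H1 H2)) : pairsys (pfst z) (psnd z) = z.
Proof. by apply/ffunP => j; rewrite !ffunE; case: (z j). Qed.

Lemma sum_pairsys H1 H2 (F : sys (jointH H1 H2) -> C) :
  \sum_z F z = \sum_x \sum_y F (pairsys x y).
Proof.
rewrite pair_bigA (reindex (fun p : sys H1 * sys H2 => pairsys p.1 p.2)) //=.
exists (fun z => (pfst z, psnd z)) => [[x y] _|z _] /=.
  by rewrite pfstK psndK.
exact: pairsysK.
Qed.

Definition sext H1 H2 G (E : cmap R (sys H1) (sys G))
    : cmap R (sys (jointH H1 H2)) (sys (jointH G H2)) :=
  fun X x y => E (fun a c => X (pairsys a (psnd x)) (pairsys c (psnd y))) (pfst x) (pfst y).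

Lemma sext_tmap H1 H2 G (L : forall j, cmap R (H1 j) (G j)) :
  (forall j, is_cp (L j)) ->
  @sext H1 H2 G (tmap L) = tmap (fun j => @lext R (H1 j) (G j) (H2 j) (L j)).
Proof.
move=> cL; apply/funext => X; apply/funext => x'; apply/funext => y'.
rewrite /sext /tmap sum_pairsys; apply: eq_bigr => a _.
pose P c := \prod_(j < n) L j (munit R (a j) (c j)) (pfst x' j) (pfst y' j).
(* The indices of the idle systems are reinstated as sums against Kronecker deltas, to match the sum
   over the whole joint basis on the other side. *)
transitivity (\sum_b (b == psnd x')%:R * \sum_c \sum_d (d == psnd y')%:R *
    (X (pairsys a b) (pairsys c d) * P c)).
  by rewrite sum_ebasis; apply: eq_bigr => c _; rewrite sum_ebasis.
apply: eq_bigr => b _; rewrite sum_pairsys mulr_sumr; apply: eq_bigr => c _.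
rewrite mulr_sumr; apply: eq_bigr => d _; rewrite -!prod_eq_sys /P.
set p1 := \prod_j _; set p2 := \prod_j _; set p3 := \prod_j _; set p4 := \prod_j _.
suff -> : p4 = p1 * p2 * p3 by ring.
rewrite -!big_split; apply: eq_bigr => j _ /=; rewrite !ffunE /lext /=.
pose k : C := (b j == (x' j).2)%:R * (d j == (y' j).2)%:R.
rewrite -/k (_ : (fun a0 c0 => _) = fun x y => k * munit R (a j) (c j) x y).
  by rewrite is_cpZ.
apply/funext => u; apply/funext => v; rewrite /munit /k !xpair_eqE -!mulnb !natrM.
by rewrite ![_ == (_ j).2]eq_sym; ring.
Qed.

Lemma LOCC_sext H1 H2 G (O : finType) (E : O -> cmap R (sys H1) (sys G)) :
  LOCC E -> LOCC (fun o => @sext H1 H2 G (E o)).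
Proof.
elim=> [H1' G' Oj L iL|H1' G' H' O1 O2 F E1 _ lF _ lE|H1' G' O1 O' E1 f _ lE].
- have -> : (fun o : {dffun forall j, Oj j} => @sext H1' H2 G' (tmap (fun j => L j (o j))))
    = fun o => tmap (fun j => @lext R (H1' j) (G' j) (H2 j) (L j (o j))).
    by apply/funext => o; apply: sext_tmap => j; have [] := iL j.
  apply: (LOCC_local (L := fun j o => @lext R (H1' j) (G' j) (H2 j) (L j o))) => j.
  exact: is_instrument_lext.
- have := LOCC_seq lF lE; congr LOCC.
  apply/funext => p; apply/funext => X; apply/funext => x; apply/funext => y.
  rewrite /sext; congr (E1 _ _ _ _ _); apply/funext => a; apply/funext => c.
  by rewrite !pfstK !psndK.
- exact: LOCC_coarse f lE.
Qed.

Lemma tmap_lptrace H1 H2 (X : op R (sys (jointH H1 H2))) :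
  tmap (fun j => @lptrace R (H1 j) (H2 j)) X = redY X.
Proof.
apply/funext => b'; apply/funext => d'; rewrite /tmap /redY sum_pairsys.
apply: eq_bigr => a _.
transitivity (\sum_b (b == b')%:R * \sum_c (c == a)%:R * \sum_d (d == d')%:R *
    X (pairsys a b) (pairsys c d)); last by rewrite !sum_ebasis.
apply: eq_bigr => b _; rewrite sum_pairsys mulr_sumr; apply: eq_bigr => c _.
rewrite !mulr_sumr; apply: eq_bigr => d _; rewrite -!prod_eq_sys.
set p1 := \prod_j _; set p2 := \prod_j _; set p3 := \prod_j _; set p4 := \prod_j _.
suff -> : p1 = p2 * p3 * p4 by ring.
rewrite -!big_split; apply: eq_bigr => j _ /=; rewrite !ffunE /lptrace /munit.
under eq_bigr => t _ do rewrite !xpair_eqE.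
rewrite (bigD1 (a j)) //= eqxx big1 => [|t /negPf ->] //.
rewrite addr0 ![_ == b' j]eq_sym ![_ == d' j]eq_sym ![_ == a j]eq_sym.
by rewrite -!natrM !mulnb /= andbA.
Qed.

(* [Tr_1 ((N (x) 1) X)]: the unnormalised state of the second subsystem after the
   outcome [N] on the first one. *)
Definition cond_map H1 H2 (N : op R (sys H1))
    : cmap R (sys (jointH H1 H2)) (sys H2) :=
  fun X b d => tr (opmul N (fun a c => X (pairsys a b) (pairsys c d))).

Lemma cond_mapD H1 H2 (N N' : op R (sys H1)) :
  @cond_map H1 H2 (N + N') = @cond_map H1 H2 N + @cond_map H1 H2 N'.
Proof.
by apply/funext => X; apply/funext => b; apply/funext => d; exact: tr_opmulDl.
Qed.

Lemma cond_map0 H1 H2 : @cond_map H1 H2 0 = 0.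
Proof.
apply/funext => X; apply/funext => b; apply/funext => d.
by rewrite /cond_map /tr big1 // => x _; rewrite /opmul big1 // => z _; exact: mul0r.
Qed.

Lemma tr_redY H1 H2 (X : op R (sys (jointH H1 H2))) : tr (redY X) = tr X.
Proof. by rewrite /tr /redY exchange_big sum_pairsys. Qed.

Lemma tr_redX H1 H2 (X : op R (sys (jointH H1 H2))) : tr (redX X) = tr X.
Proof. by rewrite /tr /redX sum_pairsys. Qed.

Lemma sum_cond_map H1 H2 (O : finType) (M : O -> op R (sys H1))
    (X : op R (sys (jointH H1 H2))) : is_povm M ->
  (fun b d => \sum_o cond_map (M o) X b d) = redY X :> op R (sys H2).
Proof.
move=> [_ iM]; apply/funext => b; apply/funext => d.
by rewrite /cond_map -tr_opmul_suml iM opmul_idl.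
Qed.

Lemma tr_cond_map H1 H2 (N : op R (sys H1)) (X : op R (sys (jointH H1 H2))) :
  tr (cond_map N X) = tr (opmul N (redX X)).
Proof.
rewrite /tr /cond_map /redX /opmul /tr exchange_big; apply: eq_bigr => a _.
rewrite exchange_big; apply: eq_bigr => c _; rewrite mulr_sumr.
by apply: eq_bigr.
Qed.

Lemma sepmap_cond_map H1 H2 (N : op R (sys H1)) :
  cone (@sepgen R n H1) N -> sepmap (@cond_map H1 H2 N).
Proof.
move/(cone_sub (@sepgen_prodgen R n H1)); elim=> [|_ v [a ->] _ IH].
  by rewrite cond_map0; exact: cone0.
rewrite cond_mapD.
apply: coneD => //.
(* The Kraus operator of party [j] is [<a_j| (x) 1]. *)
exists (fun j b' (x : H1 j * H2 j) => (x.2 == b')%:R * (a j x.1)^*).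
apply/funext => X; apply/funext => b'; apply/funext => d'.
rewrite /cond_map tens_ketbra tr_opmul_ketbra /bform /kraus /sandwich sum_pairsys.
apply: eq_bigr => x _.
transitivity (\sum_b (b == b')%:R * \sum_y \sum_d (d == d')%:R *
    ((ptens a x)^* * X (pairsys x b) (pairsys y d) * ptens a y)).
  by rewrite sum_ebasis; apply: eq_bigr => y _; rewrite sum_ebasis.
apply: eq_bigr => b _; rewrite sum_pairsys mulr_sumr; apply: eq_bigr => y _.
rewrite mulr_sumr; apply: eq_bigr => d _.
have pE (a0 : sys H1) (b0 c0 : sys H2) :
    \prod_(j < n) (((pairsys a0 b0 j).2 == c0 j)%:R * (a j (pairsys a0 b0 j).1)^*)
    = (b0 == c0)%:R * (ptens a a0)^*.
  rewrite big_split -prod_eq_sys rmorph_prod.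
  by congr (_ * _); apply: eq_bigr => j _; rewrite ffunE.
by rewrite !pE rmorphM /= conjCK conjC_nat; ring.
Qed.

(** In the LOCC case the protocol realising [M] runs on the first systems while the second ones stay
    idle, and what is left of the first is then traced out locally. *)
Lemma inst_cond_map mc H1 H2 (O : finType) (M : O -> op R (sys H1)) :
  in_M mc M -> inst mc (fun o => @cond_map H1 H2 (M o)).
Proof.
case: mc => [[pM [H' [E [lE EM]]]]|/sep_povm_cone[pM cM]].
  have lP : LOCC (fun _ : unit => tmap (fun j => @lptrace R (H' j) (H2 j))).
    apply: LOCC_local1 => [j|j X]; first exact: is_cp_lptrace.
    by rewrite /tr /lptrace exchange_big sum_pair.
  have := LOCC_post (@LOCC_sext H1 H2 H' O E lE) lP; congr LOCC.
  apply/funext => o; apply/funext => X; apply/funext => b; apply/funext => d.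
  rewrite tmap_lptrace /redY /sext /cond_map -EM; apply: eq_bigr => a _.
  by rewrite !pfstK !psndK.
split=> [a|X]; first exact: sepmap_cond_map.
by rewrite -tr_redY -(sum_cond_map X pM) /tr exchange_big.
Qed.

Lemma sepmap_redX H1 H2 : sepmap (@redX R n H1 H2).
Proof.
have -> : @redX R n H1 H2 = \sum_(y : sys H2)
    kraus (fun j a' (x : H1 j * H2 j) => (x == (a', y j))%:R).
  apply/funext => X; apply/funext => a'; apply/funext => c'; rewrite !fct_sumE.
  apply: eq_bigr => y _; rewrite /kraus /sandwich.
  have pE (x : sys (jointH H1 H2)) (a : sys H1) :
      \prod_(j < n) ((x j == (a j, y j))%:R : C) = (x == pairsys a y)%:R.
    by rewrite -prod_eq_sys; apply: eq_bigr => j _; rewrite ffunE.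
  rewrite -(sum_ebasis (pairsys a' y) (fun x => X x (pairsys c' y))).
  apply: eq_bigr => x _; rewrite -(sum_ebasis (pairsys c' y) (X x)) mulr_sumr.
  by apply: eq_bigr => z _; rewrite !pE conjC_nat; ring.
by apply: cone_sum => y _; apply: cone_gen; eexists.
Qed.
End Locc.

(** * An informationally complete product measurement *)

Section InfoComplete.
Variable R : realType.
Local Notation C := (R[i]).

(** The cross terms carry ['i ^+ k] or [(- 'i) ^+ k], which sum to zero over the four values of [k];
    in the last term the two phases cancel. *)
Lemma sum4_phase (u v p q : C) :
  \sum_(k < 4) (u + 'i ^+ k * v) * (p + (- 'i) ^+ k * q) = 4 * (u * p + v * q).
Proof.
have ii : ('i * 'i : C) = -1 by rewrite -expr2 sqrCi.
rewrite !big_ord_recl big_ord0 /= !exprS !expr0 !mulr1 !mulrNN ii.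
set i0 := 'i in ii *.
transitivity (4 * (u * p) + 2 * (v * q) - 2 * (i0 * i0) * (v * q)); first by ring.
by rewrite ii; ring.
Qed.

Lemma sum4_weighted_phase (u v p q : C) :
  \sum_(k < 4) 'i ^+ k * ((u + 'i ^+ k * v) * (p + (- 'i) ^+ k * q)) = 4 * (u * q).
Proof.
have ii : ('i * 'i : C) = -1 by rewrite -expr2 sqrCi.
rewrite !big_ord_recl big_ord0 /= !exprS !expr0 !mulr1 !mulrNN ii.
set i0 := 'i in ii *.
transitivity (2 * (u * q) + 2 * (v * p) + 2 * (i0 * i0) * (v * p - u * q)).
  by ring.
by rewrite ii; ring.
Qed.

Section Local.
Variable T : finType.

Definition icidx : finType := (T * T * 'I_4)%type.

(** The unscaled projections on [e_x + i^k e_y] add up to [4 * (#|T| + #|T|)] times the identity. *)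
Definition icscale : C := (sqrtC (8 * #|T|%:R))^-1.

(* For a fixed pair [(x, y)] the four phases cancel the off-diagonal terms of
   the projections on [e_x + i^k e_y], while weighting them by [i^k] isolates
   the matrix unit at [(x, y)]. *)
Definition icvec (q : icidx) : T -> C :=
  fun z => icscale * ((z == q.1.1)%:R + 'i ^+ q.2 * (z == q.1.2)%:R).

Lemma icscale_conj : icscale^* = icscale.
Proof.
by rewrite conj_Creal // ger0_real // invr_ge0 sqrtC_ge0 mulr_ge0.
Qed.

Lemma icscale_sqr : icscale * icscale = (8 * #|T|%:R)^-1.
Proof. by rewrite -invfM -expr2 sqrtCK. Qed.

Lemma card_neq0 (z : T) : (#|T|%:R : C) != 0.
Proof. by rewrite pnatr_eq0 -lt0n; apply/card_gt0P; exists z. Qed.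

Lemma ketbra_icvec x y k z w : ketbra (icvec (x, y, k)) z w =
  (8 * #|T|%:R)^-1 * (((z == x)%:R + 'i ^+ k * (z == y)%:R) *
                      ((w == x)%:R + (- 'i) ^+ k * (w == y)%:R)).
Proof.
rewrite /ketbra /icvec /= rmorphM /= icscale_conj mulrACA icscale_sqr.
by rewrite rmorphD rmorphM rmorphXn /= conjCi !conjC_nat.
Qed.

Lemma icvec_resolution : (fun z w => \sum_q ketbra (icvec q) z w) = @idop R T.
Proof.
apply/funext => z; apply/funext => w; rewrite !sum_pair /=.
have hk x y : \sum_k ketbra (icvec (x, y, k)) z w =
   (8 * #|T|%:R)^-1 * (4 * ((x == z)%:R * (w == x)%:R + (y == z)%:R * (w == y)%:R)).
  under eq_bigr => k _ do rewrite ketbra_icvec.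
  by rewrite -mulr_sumr sum4_phase !(eq_sym _ z).
have sD := sum_ebasis z (fun x => (w == x)%:R : C).
under eq_bigr => x _.
  under eq_bigr => y _ do rewrite hk.
  rewrite -!mulr_sumr big_split /= sD sumr_const; over.
rewrite -!mulr_sumr big_split /= sumrMnl sD sumr_const /idop [w == z]eq_sym.
by rewrite -mulr_natr; field; rewrite card_neq0.
Qed.

Lemma munit_icvec (x y : T) : exists kap : icidx -> C,
  munit R x y = fun z w => \sum_q kap q * ketbra (icvec q) z w.
Proof.
(* The factor [2 * #|T|] makes up for the scale [(8 * #|T|)^-1] and the 4 from the weighted phase
   sum. *)
exists (fun q : icidx => (q.1.1 == x)%:R * (q.1.2 == y)%:R * ((2 * #|T|%:R) * 'i ^+ q.2)).
apply/funext => z; apply/funext => w; rewrite !sum_pair /=.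
transitivity (\sum_a (a == x)%:R * \sum_b (b == y)%:R *
   \sum_(k < 4) (2 * #|T|%:R) * 'i ^+ k * ketbra (icvec (a, b, k)) z w); last first.
  apply: eq_bigr => a _; rewrite mulr_sumr; apply: eq_bigr => b _.
  by rewrite !mulr_sumr; apply: eq_bigr => k _; rewrite !mulrA.
rewrite !sum_ebasis /munit -mulnb natrM.
under eq_bigr => k _ do rewrite ketbra_icvec mulrACA.
rewrite -!mulr_sumr sum4_weighted_phase; field.
by rewrite card_neq0.
Qed.

Definition icinst (q : icidx) : cmap R T unit :=
  sandwich (fun (_ : unit) z => (icvec q z)^*).

Lemma tr_icinst q X : tr (icinst q X) = tr (opmul (ketbra (icvec q)) X).
Proof.
rewrite tr_opmul_ketbra /tr big_const card_unit /= addr0 /icinst /sandwich.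
by apply: eq_bigr => x _; apply: eq_bigr => y _; rewrite conjCK.
Qed.

Lemma is_instrument_icinst : is_instrument icinst.
Proof.
split=> [q|X].
  apply: (is_cp_sum (K := fun (_ : unit) _ z => (icvec q z)^*)) => X.
  by apply/funext => x; apply/funext => y; rewrite big_const card_unit /= addr0.
under eq_bigr => q _ do rewrite tr_icinst.
by rewrite -tr_opmul_suml icvec_resolution opmul_idl.
Qed.
End Local.

Section Global.
Variable n : nat.
Implicit Types H : 'I_n -> finType.

Definition icout H : finType := {dffun forall j, icidx (H j)}.

Definition icpovm H (a : icout H) : op R (sys H) :=
  tens (fun j => ketbra (icvec (a j))).

(** Every party measures on its own, so a single local round that consumes all systems implements
    it. *)
Lemma in_M_icpovm mc H : in_M mc (@icpovm H).
Proof.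
have pM : is_povm (@icpovm H).
  split=> [a|]; first by apply: psd_tens => j; exact: psd_ketbra.
  apply/funext => x; apply/funext => y.
  rewrite -(prod_sum_dffun (fun j q => ketbra (icvec q) (x j) (y j))).
  rewrite /idop -prod_eq_sys; apply: eq_bigr => j _.
  by have /(congr1 (fun F => F (x j) (y j))) := icvec_resolution (H j).
case: mc; last first.
  apply/sep_povm_cone; split=> // a; apply: cone_gen; eexists; split; last by [].
  by move=> j; exact: psd_ketbra.
split=> //; exists (@unitH n), (fun a : icout H => tmap (fun j => icinst (a j))); split.
  by apply: (LOCC_local (L := fun j => @icinst (H j))) => j; exact: is_instrument_icinst.
move=> a X; rewrite /icpovm tens_ketbra tr_opmul_ketbra /tr.
rewrite (big_pred1 ([ffun=> tt] : sys (@unitH n))); last first.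
  by move=> f; apply/esym/eqP/ffunP => j; rewrite ffunE; case: (f j).
apply: eq_bigr => x _; apply: eq_bigr => y _; rewrite mulrC [RHS]mulrAC; congr (_ * _).
rewrite rmorph_prod -big_split; apply: eq_bigr => j _ /=.
by rewrite /icinst sandwich_munit conjCK.
Qed.

(** State tomography: the local expansions of matrix units multiply up. The coefficients do not
    depend on [rho], so closeness of outcome probabilities transfers to entries. *)
Lemma icpovm_complete H (x y : sys H) : exists kap : icout H -> C,
  forall rho : op R (sys H), rho x y = \sum_a kap a * tr (opmul (icpovm a) rho).
Proof.
have [kap kapP] := dep_choice (fun j => @munit_icvec (H j) (y j) (x j)).
exists (fun a : icout H => \prod_(j < n) kap j (a j)) => rho.
rewrite -tr_opmul_munit.
have -> : munit R y x = fun z w => \sum_(a : icout H)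
    (\prod_(j < n) kap j (a j)) * icpovm a z w.
  apply/funext => z; apply/funext => w; rewrite /munit.
  transitivity (\prod_(j < n) munit R (y j) (x j) (z j) (w j)).
    rewrite -mulnb natrM -!prod_eq_sys -big_split.
    by apply: eq_bigr => j _; rewrite /munit -mulnb natrM.
  under eq_bigr => j _ do rewrite kapP.
  by rewrite prod_sum_dffun; apply: eq_bigr => a _; rewrite big_split.
rewrite /tr /opmul; transitivity (\sum_(a : icout H) \sum_z \sum_w
    (\prod_(j < n) kap j (a j)) * (icpovm a w z * rho z w)).
  rewrite [RHS]exchange_big; apply: eq_bigr => z _; rewrite [RHS]exchange_big.
  by apply: eq_bigr => w _; rewrite mulr_sumr; apply: eq_bigr => a _; ring.
apply: eq_bigr => a _; rewrite exchange_big mulr_sumr; apply: eq_bigr => w _.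
by rewrite mulr_sumr.
Qed.
End Global.
End InfoComplete.

(** * Classical relative entropy *)

Section RelativeEntropy.
Variable R : realType.
Local Open Scope ereal_scope.

(** One summand with values in the extended reals. It turns the case distinction in [relent] into a
    plain sum whose terms are never [-oo]. *)
Definition klterm (a b : R) : \bar R :=
  if (0 < a)%R then (if b == 0%R then +oo else (a * ln (a / b))%:E) else 0.

Lemma klterm_gtNy a b : klterm a b != -oo.
Proof. by rewrite /klterm; case: ifP => // _; case: ifP. Qed.

Lemma klterm0 b : klterm 0 b = 0.
Proof. by rewrite /klterm ltxx. Qed.

Lemma relentE (O : finType) (p q : O -> R) : relent p q = \sum_o klterm (p o) (q o).
Proof.
rewrite /relent; case: ifPn => [/existsP[a /andP[p0 /eqP q0]]|].
  apply/esym/eqP; rewrite esum_eqy => [|i _]; last exact: klterm_gtNy.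
  by apply/existsP; exists a; rewrite /klterm p0 q0 eqxx.
rewrite negb_exists => /forallP h; rewrite -sumEFin big_mkcond /=.
apply: eq_bigr => a _; rewrite /klterm; case: ifP => // p0.
by case: ifP => // q0; have := h a; rewrite p0 q0.
Qed.

Lemma ln_le_subr1 (x : R) : (0 < x)%R -> (ln x <= x - 1)%R.
Proof.
move=> x0; have := @le_ln1Dx R (x - 1); rewrite (_ : 1 + (x - 1) = x)%R; last by ring.
by apply; lra.
Qed.

(** The left side is the tangent of the convex homogeneous function [a * ln (a / b)] along the ray
    [a = c * b]; the inequality is [ln x <= x - 1] at [x = b * c / a]. *)
Lemma klterm_tangent (a b c : R) : (0 <= a)%R -> (0 <= b)%R -> (0 < c)%R ->
  (a * ln c + a - b * c)%:E <= klterm a b.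
Proof.
rewrite le_eqVlt => /orP[/eqP <- b0 c0|a0 b0 c0].
  by rewrite klterm0 mul0r !add0r lee_fin oppr_le0 mulr_ge0 // ltW.
rewrite /klterm a0; case: eqP => [_|/eqP bn0]; first exact: leey.
have {}b0 : (0 < b)%R by rewrite lt_neqAle eq_sym bn0.
rewrite lee_fin.
have := ln_le_subr1 (divr_gt0 (mulr_gt0 b0 c0) a0).
rewrite !ln_div ?posrE ?mulr_gt0 // lnM ?posrE // => h.
have := ler_wpM2l (ltW a0) h.
rewrite [X in (_ <= X)%R](_ : _ = b * c - a)%R; last by field; rewrite gt_eqF.
by move=> h2; lra.
Qed.

(* Since [2 a - 2 sqrt (a b) = a - b + (sqrt a - sqrt b)^2], this is
   [ln x <= x - 1] at [x = sqrt (b / a)]. *)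
Lemma klterm_hellinger (a b : R) : (0 <= a)%R -> (0 <= b)%R ->
  (a - b + (Num.sqrt a - Num.sqrt b) ^+ 2)%:E <= klterm a b.
Proof.
rewrite le_eqVlt => /orP[/eqP <- b0|a0 b0].
  by rewrite klterm0 sqrtr0 !sub0r sqrrN sqr_sqrtr // addNr.
rewrite /klterm a0; case: eqP => [_|/eqP bn0]; first exact: leey.
have {bn0}b0 : (0 < b)%R by rewrite lt_neqAle eq_sym bn0.
rewrite lee_fin.
have s0 : (0 < Num.sqrt a)%R by rewrite sqrtr_gt0.
have t0 : (0 < Num.sqrt b)%R by rewrite sqrtr_gt0.
have := sqr_sqrtr (ltW a0); have := sqr_sqrtr (ltW b0).
move: (Num.sqrt a) (Num.sqrt b) s0 t0 => s t s0 t0 tb sa.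
have := ln_le_subr1 (divr_gt0 t0 s0).
rewrite -sa -tb !expr2 !ln_div ?posrE ?mulr_gt0 // !lnM ?posrE // => h.
have := ler_wpM2l (ltW (mulr_gt0 s0 s0)) h.
rewrite [X in (_ <= X)%R](_ : _ = s * t - s * s)%R; last by field; rewrite gt_eqF.
by move=> h2; lra.
Qed.

Lemma relent_hellinger (O : finType) (p q : O -> R) :
  (forall o, 0 <= p o)%R -> (forall o, 0 <= q o)%R ->
  (\sum_o p o - \sum_o q o + \sum_o (Num.sqrt (p o) - Num.sqrt (q o)) ^+ 2)%R%:E
    <= relent p q.
Proof.
move=> p0 q0; rewrite relentE -sumrB -big_split -sumEFin.
by apply: lee_sum => a _; apply: klterm_hellinger.
Qed.

Lemma relent_ge0 (O : finType) (p q : O -> R) :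
  (forall o, 0 <= p o)%R -> (forall o, 0 <= q o)%R ->
  (\sum_o p o = \sum_o q o)%R -> 0 <= relent p q.
Proof.
move=> p0 q0 pq; apply: le_trans (relent_hellinger p0 q0).
by rewrite pq subrr add0r lee_fin sumr_ge0 // => a _; exact: sqr_ge0.
Qed.

Lemma relent_refl (O : finType) (p : O -> R) : (forall o, 0 <= p o)%R ->
  relent p p = 0.
Proof.
move=> p0; rewrite relentE big1 // => a _; rewrite /klterm; case: ifP => // pa.
by rewrite gt_eqF // divff ?gt_eqF // ln1 mulr0.
Qed.

Lemma psumr_eq0_all (I : finType) (F : I -> R) : (forall i, 0 <= F i)%R ->
  (\sum_i F i = 0)%R -> forall i, F i = 0%R.
Proof.
move=> F0 /eqP; rewrite psumr_eq0 // => /allP h i.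
by apply/eqP/h; rewrite mem_index_enum.
Qed.

Lemma psumr_gt0_exists (I : finType) (F : I -> R) : (forall i, 0 <= F i)%R ->
  (0 < \sum_i F i)%R -> exists i, (0 < F i)%R.
Proof.
move=> F0 s0; apply/existsP; apply: contraTT s0; rewrite negb_exists => /forallP h.
by rewrite big1 ?ltxx // => i _; apply: le_anti; rewrite F0 andbT leNgt h.
Qed.

(* Log-sum inequality: the tangent at the common slope [ln (A / B)]. *)
Lemma klterm_sum (I : finType) (a b : I -> R) :
  (forall i, 0 <= a i)%R -> (forall i, 0 <= b i)%R ->
  klterm (\sum_i a i)%R (\sum_i b i)%R <= \sum_i klterm (a i) (b i).
Proof.
move=> a0 b0; set A := (\sum_i a i)%R; set B := (\sum_i b i)%R.
have : (0 <= A)%R by apply: sumr_ge0.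
rewrite le_eqVlt => /orP[/eqP A0|A0].
  rewrite -A0 klterm0 big1 // => i _.
  by rewrite (psumr_eq0_all a0 (esym A0)) klterm0.
have : (0 <= B)%R by apply: sumr_ge0.
rewrite le_eqVlt => /orP[/eqP B0|B0].
  have [i ai] := psumr_gt0_exists a0 A0.
  suff -> : \sum_i klterm (a i) (b i) = +oo by exact: leey.
  apply/eqP; rewrite esum_eqy => [|? _]; last exact: klterm_gtNy.
  apply/existsP; exists i.
  by rewrite /klterm ai (psumr_eq0_all b0 (esym B0)) eqxx.
have := lee_sum (index_enum I) (P := predT)
  (fun i _ => klterm_tangent (a0 i) (b0 i) (divr_gt0 A0 B0)).
apply: le_trans; rewrite sumEFin sumrB big_split /= -!mulr_suml -/A -/B.
rewrite /klterm A0 gt_eqF // lee_fin.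
by rewrite [(B * _)%R]mulrC divfK ?gt_eqF // addrK.
Qed.

Lemma klterm_scale (s t a b : R) : (0 < s)%R -> (0 < t)%R -> (0 <= a)%R -> (0 <= b)%R ->
  klterm (s * a) (t * b) = (s * a * ln (s / t))%:E + s%:E * klterm a b.
Proof.
move=> s0 t0; rewrite le_eqVlt => /orP[/eqP <- _|a0 b0].
  by rewrite mulr0 !klterm0 mul0r mule0 add0r.
rewrite /klterm pmulr_rgt0 // a0 mulf_eq0 (gt_eqF t0) /=.
case: eqP => [_|/eqP bn0]; first by rewrite gt0_muley ?lte_fin // addey.
have {bn0}b0 : (0 < b)%R by rewrite lt_neqAle eq_sym bn0.
rewrite -EFinM -EFinD; congr _%:E.
by rewrite !ln_div ?posrE ?mulr_gt0 // !lnM ?posrE //; ring.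
Qed.

Lemma klterm_homog (t a b : R) : (0 <= t)%R -> (0 <= a)%R -> (0 <= b)%R ->
  klterm (t * a) (t * b) = t%:E * klterm a b.
Proof.
rewrite le_eqVlt => /orP[/eqP <- _ _|t0 a0 b0].
  by rewrite !mul0r klterm0 mul0e.
by rewrite klterm_scale // divff ?gt_eqF // ln1 mulr0 add0r.
Qed.

Lemma klterm_sumr (I : finType) (w : R) (a b : I -> R) :
  w%:E * (\sum_i klterm (a i) (b i)) = \sum_i w%:E * klterm (a i) (b i).
Proof.
apply: fin_num_sume_distrr => // i j _ _.
by apply: ltninfty_adde_def; rewrite inE ltNye klterm_gtNy.
Qed.

(** The log-sum inequality outcome by outcome, once homogeneity has moved the weights inside. *)
Lemma relent_convex (I O : finType) (w : I -> R) (p q : I -> O -> R) :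
  (forall i, 0 <= w i)%R -> (forall i o, 0 <= p i o)%R -> (forall i o, 0 <= q i o)%R ->
  relent (fun o => \sum_i w i * p i o)%R (fun o => \sum_i w i * q i o)%R
    <= \sum_i (w i)%:E * relent (p i) (q i).
Proof.
move=> w0 p0 q0; rewrite relentE.
under [X in _ <= X]eq_bigr => i _ do rewrite relentE klterm_sumr.
rewrite exchange_big; apply: lee_sum => a _.
under eq_bigr => i _ do rewrite -klterm_homog //.
by apply: klterm_sum => i; apply: mulr_ge0.
Qed.

Lemma relent_chain_infty (O O2 : finType) (P Q : O * O2 -> R) o :
  (forall x, 0 <= P x)%R -> (forall x, 0 <= Q x)%R ->
  (0 < \sum_i P (o, i))%R -> (\sum_i Q (o, i) = 0)%R -> relent P Q = +oo.
Proof.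
move=> P0 Q0 pP qQ.
have [i Pi] := psumr_gt0_exists (fun i => P0 (o, i)) pP.
rewrite /relent ifT //; apply/existsP; exists (o, i).
by rewrite Pi (psumr_eq0_all (fun i => Q0 (o, i)) qQ i) eqxx.
Qed.

Lemma relent_chain (O O2 : finType) (P Q : O * O2 -> R) (p q : O -> R) :
  (forall x, 0 <= P x)%R -> (forall x, 0 <= Q x)%R ->
  (forall o, \sum_i P (o, i) = p o)%R -> (forall o, \sum_i Q (o, i) = q o)%R ->
  (forall o, 0 < p o -> 0 < q o)%R ->
  relent P Q = relent p q + \sum_(o | (0 < p o)%R) (p o)%:E *
    relent (fun i => (p o)^-1 * P (o, i))%R (fun i => (q o)^-1 * Q (o, i))%R.
Proof.
move=> P0 Q0 pE qE pq; rewrite !relentE.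
have -> : \sum_o klterm (p o) (q o) = \sum_(o | (0 < p o)%R) (p o * ln (p o / q o))%:E.
  rewrite [RHS]big_mkcond; apply: eq_bigr => a _; rewrite /klterm; case: ifP => // pa.
  by rewrite gt_eqF ?pq.
rewrite -big_split [RHS]big_mkcond /=.
transitivity (\sum_o \sum_i klterm (P (o, i)) (Q (o, i))).
  by rewrite pair_bigA; apply: eq_bigr => -[].
apply: eq_bigr => a _; case: ifPn => [pa|pa].
  have qa := pq a pa.
  rewrite relentE klterm_sumr.
  have -> : (p a * ln (p a / q a))%:E = \sum_i (P (a, i) * ln (p a / q a))%:E.
    by rewrite sumEFin -mulr_suml pE.
  rewrite -big_split; apply: eq_bigr => i _ /=.
  have pK : (p a * ((p a)^-1 * P (a, i)) = P (a, i))%R by rewrite mulVKf ?gt_eqF.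
  have qK : (q a * ((q a)^-1 * Q (a, i)) = Q (a, i))%R by rewrite mulVKf ?gt_eqF.
  rewrite -[in LHS]pK -[in LHS]qK klterm_scale ?mulr_ge0 ?invr_ge0 ?(ltW pa) ?(ltW qa) //.
  by rewrite pK.
have pa0 : (\sum_i P (a, i) = 0)%R.
  by apply: le_anti; rewrite sumr_ge0 // andbT pE leNgt.
by rewrite big1 // => i _; rewrite (psumr_eq0_all (fun i => P0 (a, i)) pa0) klterm0.
Qed.

Lemma relent_inj (O O' : finType) (f : O -> O') (p q : O -> R) : injective f ->
  relent (fun o' => \sum_(o | f o == o') p o)%R (fun o' => \sum_(o | f o == o') q o)%R
    = relent p q.
Proof.
move=> fI; rewrite !relentE [RHS](partition_big f predT) //=.
apply: eq_bigr => o' _.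
have [x /eqP <-|h] := pickP [pred x | f x == o']; last by rewrite !big_pred0 ?klterm0.
by rewrite !(big_pred1 x) // => y; rewrite (inj_eq fI).
Qed.

(** For finite [x] one may subtract it and divide by [p]. For [x = +oo] a single element of [A]
    already forces [V = +oo], which is where inhabitation of [A] enters. *)
Lemma adde_mul_sup_le (p : R) (x V : \bar R) (A : set \bar R) : (0 < p)%R ->
  0 <= x -> (exists a, A a) -> (forall a, A a -> 0 <= a) ->
  (forall a, A a -> x + p%:E * a <= V) -> x + p%:E * ereal_sup A <= V.
Proof.
move=> p0 x0 [a0 Aa0] A0 h; case: x x0 h => [x _ h|_ h|//].
  rewrite addeC -leeBrDr // -lee_pdivlMl //; apply/ereal_supP => a Aa.
  by rewrite lee_pdivlMl // leeBrDr // addeC; apply: h.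
have := h _ Aa0; rewrite addye ?leye_eq => [/eqP ->|]; first exact: leey.
by rewrite -ltNye (lt_le_trans ltNy0) // mule_ge0 ?lee_fin ?(ltW p0) ?A0.
Qed.

(** Suprema are taken one summand at a time. This is how measurements chosen separately for each
    outcome of an instrument are assembled into one bound. *)
Lemma sum_mul_sup_le (I : eqType) (r : seq I) (p : I -> R) (A : I -> set \bar R)
    (V : \bar R) :
  uniq r -> (forall i, i \in r -> 0 < p i)%R ->
  (forall i, i \in r -> exists a, A i a) -> (forall i a, i \in r -> A i a -> 0 <= a) ->
  (forall w, (forall i, i \in r -> A i (w i)) -> \sum_(i <- r) (p i)%:E * w i <= V) ->
  \sum_(i <- r) (p i)%:E * ereal_sup (A i) <= V.
Proof.
move=> ur p0 nA A0 h.
(* The accumulator [x] holds the terms already fixed to an element of their set. *)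
suff gen x : 0 <= x ->
    (forall w, (forall i, i \in r -> A i (w i)) ->
       x + \sum_(i <- r) (p i)%:E * w i <= V) ->
    x + \sum_(i <- r) (p i)%:E * ereal_sup (A i) <= V.
  by rewrite -[X in X <= _]add0e; apply: gen => // w Aw; rewrite add0e; apply: h.
elim: r ur p0 nA A0 {h} x => [_ _ _ _|i r IH /= /andP[ir ur] p0 nA A0] x x0 h.
  by have := h (fun=> 0); rewrite !big_nil; apply.
have sup0 k : k \in r -> 0 <= (p k)%:E * ereal_sup (A k).
  move=> kr; have [a Aa] : exists a, A k a by apply: nA; rewrite inE kr orbT.
  rewrite mule_ge0 //; first by rewrite lee_fin ltW // p0 // inE kr orbT.
  apply: le_trans (A0 _ _ _ Aa) _; first by rewrite inE kr orbT.
  exact: ereal_sup_ubound.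
rewrite big_cons [_ * _ + _]addeC addeA; apply: adde_mul_sup_le.
- by rewrite p0 ?mem_head.
- by rewrite adde_ge0 // big_seq sume_ge0.
- by apply: nA; rewrite mem_head.
- by move=> a; apply: A0; rewrite mem_head.
move=> a Aa; rewrite addeAC; apply: IH => //.
- by move=> k kr; rewrite p0 // inE kr orbT.
- by move=> k kr; apply: nA; rewrite inE kr orbT.
- by move=> k b kr; apply: A0; rewrite inE kr orbT.
- by rewrite adde_ge0 // mule_ge0 ?(A0 _ _ (mem_head _ _) Aa) // lee_fin ltW // p0 // mem_head.
move=> w Aw.
(* Since [i] does not recur in [r], overriding [w] at [i] leaves the tail unchanged. *)
have -> : \sum_(k <- r) (p k)%:E * w k =
    \sum_(k <- r) (p k)%:E * (if k == i then a else w k).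
  apply: eq_big_seq => k kr; case: eqP => // ki.
  by move: ir; rewrite -ki kr.
rewrite -addeA; have := h (fun k => if k == i then a else w k).
rewrite big_cons eqxx; apply => k; rewrite inE => /orP[/eqP ->|kr].
  by rewrite eqxx.
by case: eqP => [->//|_]; exact: Aw.
Qed.

Lemma adde_mul_inf_ge (p : R) (x V : \bar R) (A : set \bar R) : (0 < p)%R ->
  0 <= x -> (forall a, A a -> 0 <= a) ->
  (forall a, A a -> V <= x + p%:E * a) -> V <= x + p%:E * ereal_inf A.
Proof.
move=> p0 x0 A0 h; case: x x0 h => [x _ h|_ h|//].
  rewrite addeC -leeBlDr // -lee_pdivrMl //; apply/ereal_infP => a Aa.
  by rewrite lee_pdivrMl // leeBlDr // addeC; apply: h.
rewrite addye ?leey // -ltNye (lt_le_trans ltNy0) // mule_ge0 ?lee_fin ?(ltW p0) //.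
by apply/ereal_infP.
Qed.

(** The dual of [sum_mul_sup_le]; for convexity it allows a free state to be picked independently
    for each component of the mixture. *)
Lemma sum_mul_inf_ge (I : eqType) (r : seq I) (p : I -> R) (A : I -> set \bar R)
    (V : \bar R) :
  uniq r -> (forall i, i \in r -> 0 < p i)%R -> (forall i a, A i a -> 0 <= a) ->
  (forall w, (forall i, i \in r -> A i (w i)) -> V <= \sum_(i <- r) (p i)%:E * w i) ->
  V <= \sum_(i <- r) (p i)%:E * ereal_inf (A i).
Proof.
move=> ur p0 A0 h.
suff gen x : 0 <= x ->
    (forall w, (forall i, i \in r -> A i (w i)) ->
       V <= x + \sum_(i <- r) (p i)%:E * w i) ->
    V <= x + \sum_(i <- r) (p i)%:E * ereal_inf (A i).
  by rewrite -[X in _ <= X]add0e; apply: gen => // w Aw; rewrite add0e; apply: h.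
elim: r ur p0 {h} x => [_ _|i r IH /= /andP[ir ur] p0] x x0 h.
  by have := h (fun=> 0); rewrite !big_nil; apply.
have inf0 k : k \in r -> 0 <= (p k)%:E * ereal_inf (A k).
  move=> kr; rewrite mule_ge0 //; first by rewrite lee_fin ltW // p0 // inE kr orbT.
  by apply/ereal_infP => a; exact: A0.
rewrite big_cons [_ * _ + _]addeC addeA; apply: adde_mul_inf_ge.
- by rewrite p0 ?mem_head.
- by rewrite adde_ge0 // big_seq sume_ge0.
- exact: A0.
move=> a Aa; rewrite addeAC; apply: IH => //.
- by move=> k kr; rewrite p0 // inE kr orbT.
- by rewrite adde_ge0 // mule_ge0 ?(A0 _ _ Aa) // lee_fin ltW // p0 // mem_head.
move=> w Aw.
have -> : \sum_(k <- r) (p k)%:E * w k =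
    \sum_(k <- r) (p k)%:E * (if k == i then a else w k).
  apply: eq_big_seq => k kr; case: eqP => // ki.
  by move: ir; rewrite -ki kr.
rewrite -addeA; have := h (fun k => if k == i then a else w k).
rewrite big_cons eqxx; apply => k; rewrite inE => /orP[/eqP ->|kr].
  by rewrite eqxx.
by case: eqP => [->//|_]; exact: Aw.
Qed.
End RelativeEntropy.

(** * Closedness of the free states *)

Section ComplexLimits.
Variable R : realType.
Local Notation C := (R[i]).
Import numFieldNormedType.Exports.
Local Open Scope classical_set_scope.

Lemma normc_Im (z : C) : ((`|complex.Im z|)%:C)%C <= `|z|.
Proof.
by rewrite normc_def lecR -sqrtr_sqr ler_wsqrtr // lerDr sqr_ge0.
Qed.

Lemma ge0_approx (z : C) :
  (forall e : R, 0 < e -> exists2 w : C, 0 <= w & `|z - w| <= (e%:C)%C) -> 0 <= z.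
Proof.
move=> h.
have re e : 0 < e -> - e <= complex.Re z /\ `|complex.Im z| <= e.
  move=> e0; have [w w0 zw] := h e e0.
  have := le_trans (normc_ge_Re _) zw; have := le_trans (normc_Im _) zw.
  rewrite !lecR; move: w0; rewrite lecE /= => /andP[/eqP im0 re0].
  case: z w im0 re0 {h zw} => [a b] [c d] /= -> c0.
  rewrite subr0 => -> /ler_normlP[]; split=> //; lra.
rewrite lecE /=; apply/andP; split.
  rewrite -normr_eq0 eq_le normr_ge0 andbT.
  apply/ler_addgt0Pr => e e0; rewrite add0r; exact: (re e e0).2.
by apply/ler_addgt0Pr => e e0; have := (re e e0).1; lra.
Qed.

Variable X : topologicalType.
Implicit Types F G : X -> C.

(** Continuity through the two real coordinates keeps all topology in [R], where segments are
    compact and the extreme value theorem applies. *)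
Definition ccont F :=
  continuous (fun x => complex.Re (F x)) /\ continuous (fun x => complex.Im (F x)).

Lemma ccontD F G : ccont F -> ccont G -> ccont (fun x => F x + G x).
Proof.
move=> [rF iF] [rG iG]; split=> x.
  rewrite (_ : (fun x => complex.Re (F x + G x))
             = fun x => complex.Re (F x) + complex.Re (G x)).
    by apply: cvgD; [exact: rF|exact: rG].
  by apply/funext => y; case: (F y) (G y) => [? ?] [? ?].
rewrite (_ : (fun x => complex.Im (F x + G x))
           = fun x => complex.Im (F x) + complex.Im (G x)).
  by apply: cvgD; [exact: iF|exact: iG].
by apply/funext => y; case: (F y) (G y) => [? ?] [? ?].
Qed.

Lemma ccontM F G : ccont F -> ccont G -> ccont (fun x => F x * G x).
Proof.
move=> [rF iF] [rG iG]; split=> x.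
  rewrite (_ : (fun x => complex.Re (F x * G x))
     = fun x => complex.Re (F x) * complex.Re (G x) - complex.Im (F x) * complex.Im (G x)).
    by apply: cvgB; apply: cvgM; [exact: rF|exact: rG|exact: iF|exact: iG].
  by apply/funext => y; case: (F y) (G y) => [? ?] [? ?].
rewrite (_ : (fun x => complex.Im (F x * G x))
     = fun x => complex.Re (F x) * complex.Im (G x) + complex.Im (F x) * complex.Re (G x)).
  by apply: cvgD; apply: cvgM; [exact: rF|exact: iG|exact: iF|exact: rG].
by apply/funext => y; case: (F y) (G y) => [? ?] [? ?].
Qed.

Lemma ccont_cst (c : C) : ccont (fun=> c).
Proof. by split; exact: cst_continuous. Qed.

Lemma ccont_conj F : ccont F -> ccont (fun x => (F x)^*).
Proof.
move=> [rF iF]; split=> x.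
  rewrite (_ : (fun x => complex.Re (F x)^*) = fun x => complex.Re (F x)); first exact: rF.
  by apply/funext => y; case: (F y).
rewrite (_ : (fun x => complex.Im (F x)^*) = fun x => - complex.Im (F x)).
  by apply: cvgN; exact: iF.
by apply/funext => y; case: (F y).
Qed.

Lemma ccont_sum (I : Type) (r : seq I) (F : I -> X -> C) :
  (forall i, ccont (F i)) -> ccont (fun x => \sum_(i <- r) F i x).
Proof.
move=> cF; elim: r => [|i r IH].
  by rewrite (_ : (fun x => _) = fun=> 0); [exact: ccont_cst|apply/funext => x; rewrite big_nil].
rewrite (_ : (fun x => _) = fun x => F i x + \sum_(i <- r) F i x).
  exact: ccontD.
by apply/funext => x; rewrite big_cons.
Qed.

Lemma ccont_prod (I : Type) (r : seq I) (F : I -> X -> C) :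
  (forall i, ccont (F i)) -> ccont (fun x => \prod_(i <- r) F i x).
Proof.
move=> cF; elim: r => [|i r IH].
  by rewrite (_ : (fun x => _) = fun=> 1); [exact: ccont_cst|apply/funext => x; rewrite big_nil].
rewrite (_ : (fun x => _) = fun x => F i x * \prod_(i <- r) F i x).
  exact: ccontM.
by apply/funext => x; rewrite big_cons.
Qed.

Lemma ccont_Complex (f g : X -> R) : continuous f -> continuous g ->
  ccont (fun x => Complex (f x) (g x)).
Proof. by []. Qed.

Lemma continuous_rsum (I : Type) (r : seq I) (F : I -> X -> R) :
  (forall i, continuous (F i)) -> continuous (fun x => \sum_(i <- r) F i x).
Proof.
move=> cF; elim: r => [|i r IH] x.
  rewrite (_ : (fun x => _) = fun=> 0); first exact: cst_continuous.
  by apply/funext => y; rewrite big_nil.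
rewrite (_ : (fun x => _) = fun x => F i x + \sum_(i <- r) F i x).
  by apply: cvgD; [exact: cF|exact: IH].
by apply/funext => y; rewrite big_cons.
Qed.

Definition cdist (z : C) : R := `|complex.Re z| + `|complex.Im z|.

Lemma continuous_cdist F : ccont F -> continuous (fun x => cdist (F x)).
Proof.
move=> [rF iF] x.
by apply: cvgD; apply: cvg_norm; [exact: rF|exact: iF].
Qed.

Lemma cdist_eq0 z : cdist z = 0 -> z = 0.
Proof.
move=> /eqP; rewrite paddr_eq0 // !normr_eq0 => /andP[/eqP r0 /eqP i0].
by case: z r0 i0 => a b /= -> ->.
Qed.

Lemma cdist_ge0 z : 0 <= cdist z.
Proof. exact: addr_ge0. Qed.

Lemma cdist_le z (e : R) : `|z| <= (e%:C)%C -> cdist z <= 2 * e.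
Proof.
move=> ze; rewrite mulr_natl mulr2n; apply: lerD.
  by rewrite -lecR; exact: le_trans (normc_ge_Re z) ze.
by rewrite -lecR; exact: le_trans (normc_Im z) ze.
Qed.
End ComplexLimits.

(** * The Caratheodory bound for cones of operators *)

Section Caratheodory.
Variable R : realType.
Local Notation C := (R[i]).
Variables (T : finType) (G : op R T -> Prop).

Definition conic m (A : op R T) :=
  exists (q : 'I_m -> R) (g : 'I_m -> op R T),
    [/\ forall i, 0 <= q i, forall i, G (g i) &
        A = fun x y => \sum_(i < m) ((q i)%:C)%C * g i x y].

(** The type [T * T * bool] indexes the real coordinates of an operator, the real and imaginary
    parts of its entries. The dependency must have real coefficients, because their signs are
    compared afterwards. *)
Lemma op_dependent m (g : 'I_m -> op R T) : (#|{: T * T * bool}| < m)%N ->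
  exists2 c : 'I_m -> R, (exists i, c i != 0) &
    forall x y, \sum_(i < m) ((c i)%:C)%C * g i x y = 0.
Proof.
move=> Nm; pose V : 'M[R]_(m, #|{: T * T * bool}|) := \matrix_(i, k)
  let t := enum_val k in
  if t.2 then complex.Re (g i t.1.1 t.1.2) else complex.Im (g i t.1.1 t.1.2).
have : kermx V != 0.
  by rewrite kermx_eq0 /row_free neq_ltn (leq_ltn_trans (rank_leq_col V)).
move/rowV0Pn => [c /sub_kermxP cV c0]; exists (c 0).
  apply/existsP; apply: contraNT c0; rewrite negb_exists => /forallP h.
  by apply/eqP/rowP => i; rewrite mxE; apply/eqP; rewrite -[_ == _]negbK h.
have cVE t : \sum_i c 0 i *
    (if t.2 then complex.Re (g i t.1.1 t.1.2) else complex.Im (g i t.1.1 t.1.2)) = 0.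
  have /(congr1 (fun M : 'rV_#|{: T * T * bool}| => M 0 (enum_rank t))) := cV.
  rewrite /= [LHS]mxE [RHS]mxE => e; rewrite -[RHS]e.
  by apply: eq_bigr => i _; rewrite mxE enum_rankK.
move=> x y.
suff -> : \sum_(i < m) ((c 0 i)%:C)%C * g i x y =
    ((\sum_i c 0 i * complex.Re (g i x y))%:C)%C +
    'i%C * ((\sum_i c 0 i * complex.Im (g i x y))%:C)%C.
  by rewrite (cVE (x, y, true)) (cVE (x, y, false)) mulr0 addr0.
rewrite !rmorph_sum mulr_sumr -big_split; apply: eq_bigr => i _ /=.
by rewrite {1}[g i x y]complexE !rmorphM /=; ring.
Qed.

(* Moving along a linear dependency until a first coefficient vanishes. *)
Lemma conic_step m A : (#|{: T * T * bool}| <= m)%N -> conic m.+1 A -> conic m A.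
Proof.
move=> Nm [q [g [q0 gG AE]]].
have [c [i1 ci1] cg] : exists2 c : 'I_m.+1 -> R, (exists i, 0 < c i) &
    forall x y, \sum_(i < m.+1) ((c i)%:C)%C * g i x y = 0.
  have [c [i ci] cg] := op_dependent g Nm.
  have [ci0|ci0] := ltP 0 (c i); first by exists c => //; exists i.
  exists (fun i => - c i).
    by exists i; rewrite oppr_gt0 lt_neqAle ci.
  move=> x y; rewrite -[RHS]oppr0 -[in RHS](cg x y) -sumrN.
  by apply: eq_bigr => k _; rewrite rmorphN mulNr.
case: (@arg_minP _ _ _ i1 [pred i | 0 < c i] (fun i => q i / c i) ci1) => i0 /= ci0 imin.
pose t := q i0 / c i0.
pose q' i := q i - t * c i.
have t0 : 0 <= t by rewrite divr_ge0 // ltW.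
have q'0 i : 0 <= q' i.
  rewrite subr_ge0; have [ci|ci] := ltP 0 (c i); last first.
    by apply: le_trans (q0 i); rewrite mulr_ge0_le0.
  by rewrite -ler_pdivlMr //; apply: imin.
have q'i0 : q' i0 = 0 by rewrite /q' /t divfK ?gt_eqF // subrr.
exists (fun k => q' (lift i0 k)), (fun k => g (lift i0 k)); split=> //.
rewrite AE; apply/funext => x; apply/funext => y.
transitivity (\sum_(i < m.+1) ((q' i)%:C)%C * g i x y); last first.
  by rewrite (bigD1_ord i0) //= q'i0 mul0r add0r.
have e : (t%:C)%C * \sum_(i < m.+1) ((c i)%:C)%C * g i x y = 0 by rewrite cg mulr0.
rewrite -[LHS]subr0 -[X in _ - X]e mulr_sumr -sumrB.
by apply: eq_bigr => i _; rewrite /q'; move: (t) => u; rewrite rmorphB rmorphM /=; ring.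
Qed.

Lemma conic_pad m A : (exists g, G g) -> conic m A -> conic m.+1 A.
Proof.
move=> [g0 Gg0] [q [g [q0 gG ->]]].
exists (fun i => oapp q 0 (unlift ord0 i)), (fun i => oapp g g0 (unlift ord0 i)); split.
- by move=> i; case: unlift => /=.
- by move=> i; case: unlift => /=.
apply/funext => x; apply/funext => y.
rewrite big_ord_recl unlift_none /= mul0r add0r.
by apply: eq_bigr => i _; rewrite liftK.
Qed.

(** The number of terms depends on the dimension alone, so one finite-parameter set covers all
    separable states. Short combinations are padded with zero weights to exactly that length. *)
Lemma conic_caratheodory m A : (exists g, G g) -> conic m A ->
  conic #|{: T * T * bool}| A.
Proof.
move=> nG; set N := #|_|.
have [mN|Nm] := leqP m N.
  by rewrite -(subnK mN); elim: (N - m)%N => [//|k IH] /IH; rewrite addSn; exact: conic_pad.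
rewrite -(subnK (ltnW Nm)); elim: (m - N)%N => [//|k IH cA]; apply: IH.
by apply: conic_step cA; exact: leq_addl.
Qed.

Lemma cone_conic A : cone (fun B => exists (q : R) g,
    [/\ 0 <= q, G g & B = fun x y => (q%:C)%C * g x y]) A -> exists m, conic m A.
Proof.
move=> /cone_finite[m [h [hG ->]]].
have [q qP] := choice hG; have [g gP] := choice qP.
exists m, q, g; split=> [i|i|]; try by have [] := gP i.
apply/funext => x; apply/funext => y; rewrite !fct_sumE; apply: eq_bigr => i _.
by have [_ _ ->] := gP i.
Qed.
End Caratheodory.

(** * Compact parametrisation of separable states, and closedness *)

Section Closedness.
Variables (R : realType) (n : nat).
Local Notation C := (R[i]).
Variable H : 'I_n -> finType.
Import numFieldNormedType.Exports.
Local Open Scope classical_set_scope.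

(** The bound on the coordinates confines the local vectors to a cube; trace one by itself would let
    the factors be rescaled against one another. *)
Definition unitprod (g : op R (sys H)) :=
  exists a : forall j, H j -> C,
    [/\ forall j x, `|a j x| <= 1, tr g = 1 & g = ketbra (ptens a)].

Lemma ketbra_normalize (T : finType) (x0 : T) (a : T -> C) :
  exists (r : R) (b : T -> C), [/\ 0 <= r, forall x, `|b x| <= 1, tr (ketbra b) = 1 &
    ketbra a = fun x y => (r%:C)%C * ketbra b x y].
Proof.
have ta0 : 0 <= tr (ketbra a) by apply: tr_ge0; exact: psd_ketbra.
have b1 (b : T -> C) : tr (ketbra b) = 1 -> forall x, `|b x| <= 1.
  move=> tb x; rewrite -(@expr_le1 _ 2) // -tb normCK /tr (bigD1 x) //= lerDl.
  by apply: sumr_ge0 => y _; apply: psd_diag_ge0; exact: psd_ketbra.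
have [t0|t0] := eqVneq (tr (ketbra a)) 0.
  exists 0, (ebasis R x0); split=> //; first by apply: b1; exact: tr_ebasis.
    exact: tr_ebasis.
  rewrite (psd_tr0 (psd_ketbra a) t0); apply/funext => x; apply/funext => y.
  by rewrite mul0r.
pose s := sqrtC (tr (ketbra a)).
have s0 : s != 0 by rewrite sqrtC_eq0.
have ss : s * s = tr (ketbra a) by rewrite -expr2 sqrtCK.
have cs : s^* = s by rewrite conj_Creal // ger0_real // sqrtC_ge0.
have kE x y : ketbra (fun x => a x / s) x y = ketbra a x y / tr (ketbra a).
  by rewrite /ketbra rmorphM /= fmorphV /= cs mulrACA -invfM ss.
have t1 : tr (ketbra (fun x => a x / s)) = 1.
  by rewrite {1}/tr; under eq_bigr => x _ do rewrite kE; rewrite -mulr_suml mulfV.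
exists (complex.Re (tr (ketbra a))), (fun x => a x / s); split=> //.
- by rewrite -ler0c ge0_ReK.
- exact: b1.
apply/funext => x; apply/funext => y; rewrite kE ge0_ReK //.
by rewrite mulrC divfK.
Qed.

Lemma sepcone_conic (x0 : sys H) A : cone (@scaled_sepgen R n H) A ->
  exists m, conic unitprod m A.
Proof.
move=> cA; apply: cone_conic; move: A cA => A; apply: cone_sub => _ [c [B [c0 pB ->]]].
have : cone (@prodgen R n H) (tens B) by apply: sepgen_prodgen; exists B.
apply: (@cone_map _ _ _ _ (fun (A : op R (sys H)) x y => (c%:C)%C * A x y)).
- by apply/funext => x; apply/funext => y; rewrite mulr0.
- by move=> X Y; apply/funext => x; apply/funext => y; exact: mulrDr.
move=> _ [a ->]; apply: cone_gen.
have [r rP] := dep_choice (fun j => ketbra_normalize (x0 j) (a j)).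
have [b bP] := dep_choice rP.
exists (c * \prod_(j < n) r j), (ketbra (ptens b)); split.
- by rewrite mulr_ge0 // prodr_ge0 // => j _; have [] := bP j.
- exists b; split=> // [j x|]; first by have [_ ->] := bP j.
  by rewrite -tens_ketbra tr_tens big1 // => j _; have [] := bP j.
apply/funext => x; apply/funext => y; rewrite -tens_ketbra rmorphM rmorph_prod -mulrA.
rewrite -big_split; congr (_ * _); apply: eq_bigr => j _ /=.
by have [_ _ _ ->] := bP j.
Qed.

Let N := #|{: sys H * sys H * bool}|.
(** For each of the [N] terms, [None] is the coordinate of its weight and [Some] gives the real
    ([true]) or imaginary ([false]) part of an entry of a local vector. *)
Let idx : eqType := ('I_N * option {j : 'I_n & (H j * bool)%type})%type.
Let X : topologicalType := prod_topology (fun _ : idx => R).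

Definition cube_bound (i : idx) : set R :=
  if i.2 is Some _ then `[-1, 1] else `[0, 1].

Definition cube : set X := [set f | forall i, cube_bound i (f i)].

Lemma compact_cube : compact cube.
Proof.
apply: (@tychonoff idx (fun=> R) cube_bound) => -[k [s|]] /=; exact: segment_compact.
Qed.

Definition pvec (f : X) (k : 'I_N) (j : 'I_n) (h : H j) : C :=
  Complex (f (k, Some (Tagged (fun j => (H j * bool)%type) (h, true))))
          (f (k, Some (Tagged (fun j => (H j * bool)%type) (h, false)))).

Definition pstate (f : X) : op R (sys H) := fun x y =>
  \sum_(k < N) ((f (k, None))%:C)%C * ketbra (ptens (pvec f k)) x y.

Lemma continuous_coord (i : idx) : continuous (fun f : X => f i).
Proof. exact: (@proj_continuous idx (fun=> R) i). Qed.

Lemma ccont_pstate x y : ccont (fun f => pstate f x y).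
Proof.
have cv k j h : ccont (fun f => @pvec f k j h).
  by apply: ccont_Complex; exact: continuous_coord.
apply: ccont_sum => k; apply: ccontM.
  by apply: ccont_Complex; [exact: continuous_coord|exact: cst_continuous].
apply: ccontM; first exact: ccont_prod.
by apply: ccont_conj; exact: ccont_prod.
Qed.

Lemma fully_separable_pstate (s : op R (sys H)) : fully_separable s ->
  exists2 f, cube f & s = pstate f.
Proof.
move=> /fully_separable_cone[cs ts].
have [x0] := tr_sys_inhabited ts.
have [m cm] := sepcone_conic x0 cs.
have nG : exists g, unitprod g.
  exists (ketbra (ptens (fun j => ebasis R (x0 j)))), (fun j => ebasis R (x0 j)); split=> //.
    by move=> j x; rewrite /ebasis normr_nat; case: eqP => // _; exact: ler01.
  by rewrite -tens_ketbra tr_tens big1 // => j _; rewrite tr_ebasis.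
have [q [g [q0 gG sE]]] := conic_caratheodory nG cm.
have [a aP] := choice gG.
pose f : X := fun i => match i.2 with
  | Some t => if (tagged t).2 then complex.Re (a i.1 (tag t) (tagged t).1)
              else complex.Im (a i.1 (tag t) (tagged t).1)
  | None => q i.1 end.
(* The generators have trace one, so the weights sum to one and each lies in [[0, 1]]. *)
have q1 : \sum_i q i = 1.
  have : tr s = ((\sum_i q i)%:C)%C.
    rewrite sE /tr exchange_big rmorph_sum; apply: eq_bigr => i _ /=.
    by rewrite -mulr_sumr -/(tr _); have [_ -> _] := aP i; rewrite mulr1.
  by rewrite ts => -[].
exists f.
  move=> [k [t|]]; rewrite /cube_bound /f /= in_itv /=.
    rewrite -ler_norml -lecR.
    have [a1 _ _] := aP k; apply: le_trans (a1 (tag t) (tagged t).1).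
    by case: ifP => _; [exact: normc_ge_Re|exact: normc_Im].
  rewrite q0 /= -q1 (bigD1 k) //= lerDl.
  by apply: sumr_ge0.
rewrite sE; apply/funext => x; apply/funext => y; apply: eq_bigr => k _.
have [_ _ ->] := aP k; congr (_ * ketbra (ptens _) x y).
apply/functional_extensionality_dep => j; apply/funext => h.
by rewrite /pvec /f /=; case: (a k j h).
Qed.

Lemma pstate_cone f : cube f -> cone (@scaled_sepgen R n H) (pstate f).
Proof.
move=> cf.
rewrite (_ : pstate f = \sum_(k < N) (fun x y =>
    ((f (k, None))%:C)%C * tens (fun j => ketbra (@pvec f k j)) x y)).
  apply: cone_sum => k _; apply: cone_gen.
  exists (f (k, None)), (fun j => ketbra (@pvec f k j)); split=> //.
    by have := cf (k, None); rewrite /cube_bound /= in_itv /= => /andP[].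
  by move=> j; exact: psd_ketbra.
apply/funext => x; apply/funext => y; rewrite !fct_sumE.
by apply: eq_bigr => k _; rewrite tens_ketbra.
Qed.

(** The distance to [rho] attains its minimum on the compact cube, and approximability makes that
    minimum zero. The cube does not impose normalisation; it is recovered from the trace of
    [rho]. *)
Lemma fully_separable_closed (rho : op R (sys H)) : is_state rho ->
  (forall e : R, 0 < e -> exists2 s, fully_separable s &
     forall x y, `|rho x y - s x y| <= (e%:C)%C) -> fully_separable rho.
Proof.
move=> [_ trho] h.
pose D (f : X) := \sum_x \sum_y cdist (rho x y - pstate f x y).
have cD : continuous D.
  apply: continuous_rsum => x; apply: continuous_rsum => y; apply: continuous_cdist.
  apply: ccontD; first exact: ccont_cst.
  rewrite (_ : (fun f => - pstate f x y) = fun f => (-1) * pstate f x y).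
    by apply: ccontM; [exact: ccont_cst|exact: ccont_pstate].
  by apply/funext => f; rewrite mulN1r.
have ne : cube !=set0.
  by have [s /fully_separable_pstate[f cf _] _] := h 1 ltr01; exists f.
have [f0 f0c f0min] := compact_EVT_min ne compact_cube (continuous_subspaceT cD).
have D0 : D f0 = 0.
  apply: le_anti; apply/andP; split; last first.
    by apply: sumr_ge0 => x _; apply: sumr_ge0 => y _; exact: cdist_ge0.
  (* Each of the entries costs at most [2 * (e / K)] in [cdist]; the [+ 1] keeps [K] positive. *)
  pose K : R := 2 * (#|sys H| * #|sys H|)%:R + 1.
  have K0 : 0 < K by rewrite ltr_wpDl // mulr_ge0.
  apply/ler_addgt0Pr => e e0; rewrite add0r.
  have [s /fully_separable_pstate[f cf ->] sr] := h (e / K) (divr_gt0 e0 K0).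
  apply: le_trans (f0min f _) _; first by rewrite inE.
  apply: (@le_trans _ _ (\sum_(x : sys H) \sum_(y : sys H) 2 * (e / K))).
    by apply: ler_sum => x _; apply: ler_sum => y _; exact: cdist_le.
  rewrite !sumr_const -mulrnA -mulr_natr.
  rewrite [X in X <= _](_ : _ = e * ((2 * (#|sys H| * #|sys H|)%:R) / K)); last by ring.
  rewrite ger_pMr // ler_pdivrMr // mul1r /K lerDl.
  exact: ler01.
apply/fully_separable_cone; split=> //.
suff -> : rho = pstate f0 by apply: pstate_cone; rewrite inE in f0c.
apply/funext => x; apply/funext => y; apply/eqP; rewrite -subr_eq0; apply/eqP.
apply: cdist_eq0; move: D0 => /eqP; rewrite psumr_eq0 => [/allP|x1 _]; last first.
  by apply: sumr_ge0 => y1 _; exact: cdist_ge0.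
move=> /(_ x); rewrite mem_index_enum => /(_ isT) /=.
rewrite psumr_eq0 => [/allP/(_ y)|y1 _]; last exact: cdist_ge0.
by rewrite mem_index_enum => /(_ isT) /eqP.
Qed.

Lemma ppt_closed (rho : op R (sys H)) : is_state rho ->
  (forall e : R, 0 < e -> exists2 s, ppt_state s &
     forall x y, `|rho x y - s x y| <= (e%:C)%C) -> ppt_state rho.
Proof.
move=> srho h; split=> // S v; apply: ge0_approx => e e0.
(* Partial transposition only permutes entries, so an entrywise error [e / (k + 1)] shifts the form
   at [v] by at most [k * e / (k + 1)]. *)
pose K := \sum_(x : sys H) \sum_(y : sys H) `|v x| * `|v y|.
have K0 : 0 <= K by apply: sumr_ge0 => x _; apply: sumr_ge0 => y _; exact: mulr_ge0.
pose k := complex.Re K.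
have k0 : 0 <= k by rewrite -ler0c ge0_ReK.
have e1 : 0 < e / (k + 1) by rewrite divr_gt0 // ltr_wpDl.
have [s [_ ps] sr] := h _ e1.
exists (\sum_x \sum_y (v x)^* * ptrans S s x y * v y); first exact: ps.
rewrite -sumrB; apply: le_trans (ler_norm_sum _ _ _) _.
apply: (@le_trans _ _ (\sum_x \sum_y (`|v x| * `|v y| * ((e / (k + 1))%:C)%C))).
  apply: ler_sum => x _; rewrite -sumrB; apply: le_trans (ler_norm_sum _ _ _) _.
  apply: ler_sum => y _; rewrite -mulrBl -mulrBr !normrM norm_conjC mulrAC.
  by apply: ler_wpM2l; [exact: mulr_ge0|exact: sr].
under eq_bigr => x _ do rewrite -mulr_suml.
rewrite -mulr_suml -/K -[K](ge0_ReK K0) -/k -rmorphM lecR mulrCA.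
by rewrite ger_pMr // ler_pdivrMr ?ltr_wpDl // mul1r lerDl ler01.
Qed.

Lemma in_P_closed pc (rho : op R (sys H)) : is_state rho ->
  (forall e : R, 0 < e -> exists2 s, in_P pc s &
     forall x y, `|rho x y - s x y| <= (e%:C)%C) -> in_P pc rho.
Proof. by case: pc; [exact: fully_separable_closed|exact: ppt_closed]. Qed.
End Closedness.

(** * The measured relative entropy of entanglement *)

Section Measured.
Variables (R : realType) (n : nat).
Local Notation C := (R[i]).
Implicit Types H G : 'I_n -> finType.

Definition scale_op (T : finType) (c : R) (A : op R T) : op R T :=
  fun x y => (c%:C)%C * A x y.

Lemma Re_sum (I : Type) (r : seq I) (P : pred I) (F : I -> C) :
  complex.Re (\sum_(i <- r | P i) F i) = \sum_(i <- r | P i) complex.Re (F i).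
Proof. by elim/big_rec2: _ => // i x y _ <-; case: (F i) (y) => [? ?] [? ?]. Qed.

Lemma Re_scale (c : R) (z : C) : complex.Re ((c%:C)%C * z) = c * complex.Re z.
Proof. by case: z => a b /=; rewrite mul0r subr0. Qed.

Lemma tr_scale (T : finType) c (A : op R T) : tr (scale_op c A) = (c%:C)%C * tr A.
Proof. by rewrite /tr mulr_sumr. Qed.

Lemma tr_opmul_scaler (T : finType) c (M A : op R T) :
  tr (opmul M (scale_op c A)) = (c%:C)%C * tr (opmul M A).
Proof.
rewrite /tr /opmul mulr_sumr; apply: eq_bigr => x _; rewrite mulr_sumr.
by apply: eq_bigr => z _; rewrite mulrCA.
Qed.

Lemma tr_opmul_sumr (T : finType) (I : Type) (r : seq I) (P : pred I)
    (M : op R T) (A : I -> op R T) :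
  tr (opmul M (fun x y => \sum_(i <- r | P i) A i x y))
    = \sum_(i <- r | P i) tr (opmul M (A i)).
Proof.
rewrite /tr /opmul [RHS]exchange_big; apply: eq_bigr => x _.
by rewrite [RHS]exchange_big; apply: eq_bigr => z _; rewrite mulr_sumr.
Qed.

Section Meas.
Variables (T O : finType) (M : O -> op R T).

Lemma meas_ge0 rho o : is_povm M -> psd rho -> 0 <= meas M rho o.
Proof.
by move=> [pM _] pr; have := tr_opmul_ge0 (pM o) pr; rewrite lecE => /andP[].
Qed.

Lemma sum_meas rho : is_povm M -> \sum_o meas M rho o = complex.Re (tr rho).
Proof. by move=> [_ iM]; rewrite /meas -Re_sum -tr_opmul_suml iM opmul_idl. Qed.

Lemma meas_scale c rho o : meas M (scale_op c rho) o = c * meas M rho o.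
Proof. by rewrite /meas tr_opmul_scaler Re_scale. Qed.

Lemma meas_sum (I : finType) (A : I -> op R T) o :
  meas M (fun x y => \sum_i A i x y) o = \sum_i meas M (A i) o.
Proof. by rewrite /meas tr_opmul_sumr Re_sum. Qed.

Lemma meas_coarse (O' : finType) (f : O -> O') rho :
  meas (fun o' x y => \sum_(o | f o == o') M o x y) rho
    = fun o' => \sum_(o | f o == o') meas M rho o.
Proof. by apply/funext => o'; rewrite /meas tr_opmul_suml Re_sum. Qed.
End Meas.

Lemma meas_relent_ge0 (T O : finType) (M : O -> op R T) rho sigma :
  is_povm M -> is_state rho -> is_state sigma ->
  (0 <= relent (meas M rho) (meas M sigma))%E.
Proof.
move=> pM [pr tr1] [ps ts1]; apply: relent_ge0 => [a|a|]; try exact: meas_ge0.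
by rewrite !sum_meas // tr1 ts1.
Qed.

Lemma in_P_state pc H (sigma : op R (sys H)) : in_P pc sigma -> is_state sigma.
Proof. by move=> /in_P_cone[/Pcone_psd]. Qed.

Definition msup (mc : mclass) H (rho sigma : op R (sys H)) : \bar R :=
  ereal_sup [set w | exists (O : finType) (M : O -> op R (sys H)),
    in_M mc M /\ w = relent (meas M rho) (meas M sigma)].

Lemma msup_ubound mc H (O : finType) (M : O -> op R (sys H)) rho sigma : in_M mc M ->
  (relent (meas M rho) (meas M sigma) <= msup mc rho sigma)%E.
Proof. by move=> MM; apply: ereal_sup_ubound; exists O, M. Qed.

Lemma MER_le mc pc H (rho sigma : op R (sys H)) : in_P pc sigma ->
  (MER mc pc rho <= msup mc rho sigma)%E.
Proof. by move=> Ps; apply: ereal_inf_lbound; exists sigma. Qed.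

Lemma le_MER mc pc H (rho : op R (sys H)) V :
  (forall sigma, in_P pc sigma -> (V <= msup mc rho sigma)%E) -> (V <= MER mc pc rho)%E.
Proof. by move=> h; apply/ereal_infP => _ [sigma [Ps ->]]; exact: h. Qed.

Lemma msup_ge0 mc H (rho sigma : op R (sys H)) : is_state rho -> is_state sigma ->
  (0 <= msup mc rho sigma)%E.
Proof.
move=> sr ss; apply: le_trans (msup_ubound rho sigma (in_M_icpovm R mc H)).
by apply: meas_relent_ge0 => //; exact: in_M_povm (in_M_icpovm R mc H).
Qed.

Lemma MER_ge0 mc pc H (rho : op R (sys H)) : is_state rho -> (0 <= MER mc pc rho)%E.
Proof.
by move=> sr; apply: le_MER => sigma Ps; apply: msup_ge0 => //; exact: in_P_state Ps.
Qed.

Lemma MER_in_P mc pc H (rho : op R (sys H)) : in_P pc rho -> MER mc pc rho = 0%E.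
Proof.
move=> Pr; have sr := in_P_state Pr.
apply/eqP; rewrite eq_le MER_ge0 // andbT; apply: le_trans (MER_le mc rho Pr) _.
apply/ereal_supP => _ [ O [M [MM ->]]]; rewrite relent_refl // => a.
by apply: meas_ge0 (in_M_povm MM) _; have [] := sr.
Qed.

(** Factor [a - b] as a difference of squares of roots; the sum of the roots is at most 2. *)
Lemma sqrt_dist_le (a b d : R) : 0 <= a <= 1 -> 0 <= b <= 1 -> 0 <= d ->
  (Num.sqrt a - Num.sqrt b) ^+ 2 <= (d / 2) ^+ 2 -> `|a - b| <= d.
Proof.
move=> /andP[a0 a1] /andP[b0 b1] d0 h.
have hs : `|Num.sqrt a - Num.sqrt b| <= d / 2.
  by rewrite -(@ler_pXn2r _ 2) ?nnegrE ?normr_ge0 ?divr_ge0 // real_normK ?num_real.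
have -> : a - b = (Num.sqrt a - Num.sqrt b) * (Num.sqrt a + Num.sqrt b).
  by rewrite -subr_sqr !sqr_sqrtr.
have s1 (c : R) : c <= 1 -> Num.sqrt c <= 1 by move=> c1; rewrite -sqrtr1 ler_wsqrtr.
rewrite normrM [X in _ * X]ger0_norm ?addr_ge0 ?sqrtr_ge0 //.
have -> : d = d / 2 * 2 by rewrite divfK.
apply: ler_pM; rewrite ?addr_ge0 ?sqrtr_ge0 //.
by have := s1 _ a1; have := s1 _ b1; lra.
Qed.

Lemma MER_eq0 mc pc H (rho : op R (sys H)) : is_state rho ->
  MER mc pc rho = 0%E -> in_P pc rho.
Proof.
move=> sr M0; apply: in_P_closed => // e e0.
have [k1 k1P] := choice (fun xy : sys H * sys H => @icpovm_complete R n H xy.1 xy.2).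
(* Coefficients for all entries are added up, so that one tolerance [d] serves every entry at
   once. *)
pose K : C := \sum_xy \sum_a `|k1 xy a|.
have K0 : 0 <= K by apply: sumr_ge0 => xy _; apply: sumr_ge0.
pose k := complex.Re K; have k0 : 0 <= k by rewrite -ler0c ge0_ReK.
pose d := e / (k + 1).
have d0 : 0 < d by rewrite divr_gt0 // ltr_wpDl.
(* Through the Hellinger bound the tolerance [(d / 2) ^+ 2] puts every outcome probability of [s]
   within [d] of that of [rho]. *)
have [_ [s [Ps ->]]] : exists2 v, [set v | exists s, in_P pc s /\ v = msup mc rho s]%classic v
    & (v < 0 + ((d / 2) ^+ 2)%:E)%E.
  have := @lb_ereal_inf_adherent R [set v | exists s, in_P pc s /\ v = msup mc rho s]%classic
    ((d / 2) ^+ 2); rewrite -/(MER mc pc rho) M0; apply => //.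
  by rewrite exprn_gt0 // divr_gt0.
rewrite add0e => hs; exists s => // x y.
have ss := in_P_state Ps.
have pM := in_M_povm (in_M_icpovm R mc H).
have pr a : 0 <= meas (@icpovm R n H) rho a <= 1.
  rewrite (meas_ge0 _ pM sr.1) /=.
  have e1 : \sum_a meas (@icpovm R n H) rho a = 1 by rewrite sum_meas // sr.2.
  by rewrite -e1 (bigD1 a) //= lerDl sumr_ge0 // => b _; apply: meas_ge0 => //; exact: sr.1.
have ps a : 0 <= meas (@icpovm R n H) s a <= 1.
  rewrite (meas_ge0 _ pM ss.1) /=.
  have e1 : \sum_a meas (@icpovm R n H) s a = 1 by rewrite sum_meas // ss.2.
  by rewrite -e1 (bigD1 a) //= lerDl sumr_ge0 // => b _; apply: meas_ge0 => //; exact: ss.1.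
have close a : `|meas (@icpovm R n H) rho a - meas (@icpovm R n H) s a| <= d.
  apply: sqrt_dist_le => //; first exact: ltW.
  have := le_lt_trans (msup_ubound rho s (in_M_icpovm R mc H)) hs.
  move=> /(le_lt_trans (relent_hellinger
    (fun a => (andP (pr a)).1) (fun a => (andP (ps a)).1))).
  rewrite !sum_meas // sr.2 ss.2 subrr add0r lte_fin => /ltW; apply: le_trans.
  by rewrite (bigD1 a) //= lerDl sumr_ge0 // => b _; exact: sqr_ge0.
have trE t a : is_state t -> tr (opmul (icpovm R a) t) = ((meas (@icpovm R n H) t a)%:C)%C.
  by move=> [pt _]; rewrite /meas ge0_ReK //; apply: tr_opmul_ge0 => //; exact: pM.1.
rewrite !(k1P (x, y)) -sumrB; apply: le_trans (ler_norm_sum _ _ _) _.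
apply: (@le_trans _ _ (\sum_a `|k1 (x, y) a| * (d%:C)%C)).
  apply: ler_sum => a _; rewrite -mulrBr normrM; apply: ler_wpM2l => //.
  by rewrite !trE // -rmorphB normc_def /= expr0n addr0 sqrtr_sqr lecR.
rewrite -mulr_suml; apply: (@le_trans _ _ (K * (d%:C)%C)).
  apply: ler_wpM2r; first by rewrite ler0c ltW.
  rewrite /K (bigD1 (x, y)) //= lerDl sumr_ge0 // => xy _.
  by apply: sumr_ge0.
rewrite -(ge0_ReK K0) -rmorphM lecR -/k /d mulrCA ger_pMr // ler_pdivrMr ?ltr_wpDl //.
by rewrite mul1r lerDl.
Qed.
End Measured.

(** * Convexity, monotonicity and superadditivity *)

Section Monotone.
Variables (R : realType) (n : nat).
Local Notation C := (R[i]).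
Implicit Types H G : 'I_n -> finType.
Local Open Scope ereal_scope.

Lemma MER_convex mc pc H m (p : 'I_m -> R) (rhos : 'I_m -> op R (sys H)) :
  (forall i, 0 <= p i)%R -> (\sum_(i < m) p i = 1)%R -> (forall i, is_state (rhos i)) ->
  MER mc pc (fun x y => \sum_(i < m) ((p i)%:C)%C * rhos i x y)%R
    <= \sum_(i < m) (p i)%:E * MER mc pc (rhos i).
Proof.
move=> p0 p1 sr; set rho := (fun x y => _).
(* [sum_mul_inf_ge] asks for positive weights; components of weight zero contribute zero whatever
   their measure. *)
rewrite (bigID (fun i => 0 < p i)%R) /= [X in _ <= _ + X]big1 => [|i pi]; last first.
  have -> : p i = 0%R by apply: le_anti; rewrite p0 andbT leNgt.
  by rewrite mul0e.
rewrite adde0 -big_filter; set r := [seq i <- _ | _].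
apply: sum_mul_inf_ge => [|i|i a|w Aw].
- by rewrite filter_uniq // index_enum_uniq.
- by rewrite mem_filter => /andP[].
- by move=> [s [Ps ->]]; apply: msup_ge0 => //; exact: in_P_state Ps.
(* For weight zero the default is the zero operator: it lies in the cone and its term in the mixture
   vanishes. *)
have h i : exists s : op R (sys H), Pcone pc s /\
    ((0 < p i)%R -> in_P pc s /\ w i = msup mc (rhos i) s).
  have [pi|pi] := boolP (0 < p i)%R.
    have [s [Ps ws]] : exists s, in_P pc s /\ w i = msup mc (rhos i) s.
      by apply: Aw; rewrite mem_filter pi mem_index_enum.
    by exists s; split=> //; have /in_P_cone[] := Ps.
  by exists (0 : op R (sys H))%R; split=> //; exact: Pcone0.
have [s sP] := choice h.
pose sigma : op R (sys H) := (fun x y => \sum_i scale_op (p i) (s i) x y)%R.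
have Psigma : in_P pc sigma.
  apply/in_P_cone; split.
    rewrite (_ : sigma = \sum_i scale_op (p i) (s i))%R.
      by apply: Pcone_sum => i _; apply: Pcone_scale => //; have [] := sP i.
    by apply/funext => x; apply/funext => y; rewrite !fct_sumE.
  rewrite /tr /sigma exchange_big /=.
  under eq_bigr => i _ do rewrite -/(tr _) tr_scale.
  transitivity ((\sum_i p i)%:C)%C; last by rewrite p1.
  rewrite rmorph_sum; apply: eq_bigr => i _.
  have := p0 i; rewrite le_eqVlt => /orP[/eqP <-|pi]; first by rewrite mul0r.
  by have [_ /(_ pi)[/in_P_cone[_ ->] _]] := sP i; rewrite mulr1.
apply: le_trans (MER_le mc rho Psigma) _.
apply/ereal_supP => _ [ O [M [MM ->]]].
have pM := in_M_povm MM.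
have -> : meas M rho = (fun o => \sum_i p i * meas M (rhos i) o)%R.
  apply/funext => o; rewrite -[rho]/(fun x y => \sum_i scale_op (p i) (rhos i) x y)%R.
  by rewrite meas_sum; apply: eq_bigr => i _; rewrite meas_scale.
have -> : meas M sigma = (fun o => \sum_i p i * meas M (s i) o)%R.
  by apply/funext => o; rewrite meas_sum; apply: eq_bigr => i _; rewrite meas_scale.
apply: le_trans (relent_convex _ _ _) _ => //.
- by move=> i o; apply: meas_ge0 => //; have [] := sr i.
- by move=> i o; apply: meas_ge0 => //; have [/Pcone_psd] := sP i.
rewrite (bigID (fun i => 0 < p i)%R) /= [X in _ + X <= _]big1 => [|i pi]; last first.
  have -> : p i = 0%R by apply: le_anti; rewrite p0 andbT leNgt.
  by rewrite mul0e.
rewrite adde0 -big_filter -/r big_seq [X in _ <= X]big_seq; apply: lee_sum => i.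
rewrite mem_filter => /andP[pi _]; apply: lee_wpmul2l; first by rewrite lee_fin.
have [_ /(_ pi)[_ ->]] := sP i; exact: msup_ubound.
Qed.

Section Chain.
Variables (mc : mclass) (H G : 'I_n -> finType) (O : finType).
Variables (F : O -> cmap R (sys H) (sys G)) (rho sigma : op R (sys H)).
Hypotheses (iF : inst mc F) (pr : psd rho) (ps : psd sigma).

Let p o := complex.Re (tr (F o rho)).
Let q o := complex.Re (tr (F o sigma)).

Lemma inst_measure_meas (O2 : finType) (M : O -> O2 -> op R (sys G)) :
  (forall o, in_M mc (M o)) ->
  relent (fun x : O * O2 => meas (M x.1) (F x.1 rho) x.2)
         (fun x : O * O2 => meas (M x.1) (F x.1 sigma) x.2) <= msup mc rho sigma.
Proof.
move=> MM; have [N [NM NE]] := inst_measure iF MM.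
have e t : (fun x : O * O2 => meas (M x.1) (F x.1 t) x.2) = meas N t.
  by apply/funext => -[a i]; rewrite /meas NE.
by rewrite !e; exact: msup_ubound.
Qed.

Let pF t o : psd t -> psd (F o t).
Proof. by move=> pt; apply: sepmap_psd pt; have [] := inst_sepinst iF. Qed.

(** An outcome possible for [rho] and impossible for [sigma] violates the support condition already;
    any measurement of the class may follow the instrument. *)
Lemma msup_chain_infty o : (0 < p o)%R -> q o = 0%R -> msup mc rho sigma = +oo.
Proof.
move=> po qo; apply/eqP; rewrite -leye_eq.
have iM (o : O) := in_M_icpovm R mc G.
apply: le_trans (inst_measure_meas iM).
have pM := in_M_povm (in_M_icpovm R mc G).
rewrite (@relent_chain_infty _ _ _ _ _ o) //=.
- by move=> x; apply: meas_ge0 => //; exact: pF.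
- by move=> x; apply: meas_ge0 => //; exact: pF.
- by rewrite sum_meas.
- by rewrite sum_meas.
Qed.

Lemma msup_chain (O2 : finType) (M : O -> O2 -> op R (sys G)) :
  (forall o, in_M mc (M o)) -> (forall o, 0 < p o -> 0 < q o)%R ->
  relent p q + \sum_(o | (0 < p o)%R) (p o)%:E *
    relent (meas (M o) (scale_op (p o)^-1 (F o rho)))
           (meas (M o) (scale_op (q o)^-1 (F o sigma))) <= msup mc rho sigma.
Proof.
move=> MM pq; apply: le_trans (inst_measure_meas MM).
rewrite (@relent_chain _ _ _ _ _ p q) //=.
- rewrite [X in _ <= _ + X](_ : _ = \sum_(o | (0 < p o)%R) (p o)%:E *
    relent (meas (M o) (scale_op (p o)^-1 (F o rho)))
           (meas (M o) (scale_op (q o)^-1 (F o sigma)))) //.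
  apply: eq_bigr => o _; congr (_ * relent _ _); apply/funext => i.
    by rewrite meas_scale.
  by rewrite meas_scale.
- by move=> x; apply: meas_ge0 (in_M_povm (MM _)) _; exact: pF.
- by move=> x; apply: meas_ge0 (in_M_povm (MM _)) _; exact: pF.
- by move=> o; rewrite sum_meas //; exact: in_M_povm (MM o).
- by move=> o; rewrite sum_meas //; exact: in_M_povm (MM o).
Qed.

Lemma inst_prob_ge0 t o : psd t -> (0 <= complex.Re (tr (F o t)))%R.
Proof. by move=> pt; rewrite -ler0c ge0_ReK; apply: tr_ge0; exact: pF. Qed.

Lemma inst_prob_sum t : (\sum_o complex.Re (tr (F o t)) = complex.Re (tr t))%R.
Proof. by rewrite -Re_sum; have [_ ->] := inst_sepinst iF. Qed.

Lemma inst_prob_posP :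
  (exists2 o, (0 < p o)%R & q o = 0%R) \/ (forall o, 0 < p o -> 0 < q o)%R.
Proof.
have [a /andP[pa /eqP qa]|h] := pickP (fun o => (0 < p o)%R && (q o == 0%R)).
  by left; exists a.
right=> o po; rewrite lt_neqAle inst_prob_ge0 // andbT eq_sym.
by have := h o; rewrite po /= => ->.
Qed.

Lemma relent_inst_ge0 : tr rho = 1%R -> tr sigma = 1%R -> 0 <= relent p q.
Proof.
move=> tr1 ts1; apply: relent_ge0 => [a|a|]; try exact: inst_prob_ge0.
by rewrite !inst_prob_sum tr1 ts1.
Qed.

Lemma is_state_inst o t : psd t -> (0 < complex.Re (tr (F o t)))%R ->
  is_state (scale_op (complex.Re (tr (F o t)))^-1 (F o t)).
Proof.
move=> pt t0; split; first by apply: psd_scale (pF o pt); rewrite ler0c invr_ge0 ltW.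
rewrite tr_scale -[X in (_ * X)%R](ge0_ReK (tr_ge0 (pF o pt))) -rmorphM mulVf //.
by rewrite gt_eqF.
Qed.

Lemma in_P_inst pc o t : Pcone pc t -> (0 < complex.Re (tr (F o t)))%R ->
  in_P pc (scale_op (complex.Re (tr (F o t)))^-1 (F o t)).
Proof.
move=> Pt t0; apply/in_P_cone; split.
  apply: Pcone_scale; first by rewrite invr_ge0 ltW.
  by apply: Pcone_sepmap Pt; have [] := inst_sepinst iF.
by have [] := is_state_inst (Pcone_psd Pt) t0.
Qed.
End Chain.

Lemma MER_inst mc pc H G (O : finType) (F : O -> cmap R (sys H) (sys G))
    (rho : op R (sys H)) : inst mc F -> is_state rho ->
  \sum_(o | (0 < complex.Re (tr (F o rho)))%R) (complex.Re (tr (F o rho)))%:E *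
      MER mc pc (scale_op (complex.Re (tr (F o rho)))^-1 (F o rho))
    <= MER mc pc rho.
Proof.
move=> iF [pr tr1]; pose p o := complex.Re (tr (F o rho)).
change (\sum_(o | (0 < p o)%R) (p o)%:E * MER mc pc (scale_op (p o)^-1 (F o rho))
          <= MER mc pc rho).
apply: le_MER => sigma /in_P_cone[Ps ts1].
have ps := Pcone_psd Ps.
have [[a pa qa]|pq] := inst_prob_posP rho iF ps.
  by rewrite (msup_chain_infty iF pr ps pa qa) leey.
pose q o := complex.Re (tr (F o sigma)).
pose A o : set \bar R := [set w | exists (O2 : finType) (M : O2 -> op R (sys G)),
    in_M mc M /\ w = relent (meas M (scale_op (p o)^-1 (F o rho)))
                            (meas M (scale_op (q o)^-1 (F o sigma)))]%classic.
(* The normalised images of one and the same [sigma] are free states, hence candidates in the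
   infimum for each outcome. *)
apply: (@le_trans _ _ (\sum_(o | (0 < p o)%R) (p o)%:E * ereal_sup (A o))).
  apply: lee_sum => o po; apply: lee_wpmul2l; first by rewrite lee_fin ltW.
  by apply: MER_le; apply: (in_P_inst iF) => //; exact: pq.
rewrite -big_filter; set r := [seq o <- _ | _].
apply: sum_mul_sup_le.
- by rewrite filter_uniq // index_enum_uniq.
- by move=> o; rewrite mem_filter => /andP[].
- move=> o _; eexists; exists _, (@icpovm R n G); split; last by [].
  exact: in_M_icpovm.
- move=> o a; rewrite mem_filter => /andP[po _] [ O2 [M [MM ->]]].
  apply: meas_relent_ge0 (in_M_povm MM) _ _; apply: (is_state_inst iF) => //.
  exact: pq.
move=> w Aw.
have h o : exists M : {O2 : finType & O2 -> op R (sys G)}, in_M mc (tagged M) /\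
    ((0 < p o)%R -> w o = relent (meas (tagged M) (scale_op (p o)^-1 (F o rho)))
                               (meas (tagged M) (scale_op (q o)^-1 (F o sigma)))).
  have [po|po] := boolP (0 < p o)%R.
    have [| O2 [M [MM wE]]] := Aw o; first by rewrite mem_filter po mem_index_enum.
    by exists (Tagged (fun O2 : finType => O2 -> op R (sys G)) M).
  exists (Tagged (fun O2 : finType => O2 -> op R (sys G)) (@icpovm R n G)).
  by split=> //; exact: in_M_icpovm.
have [M MP] := choice h.
(* The measurements picked for different outcomes have different outcome types. Their disjoint union
   hosts them all, each padded with zero effects, which does not change its relative entropy. *)
pose O2 : finType := {o : O & tag (M o)}.
pose inj o (i : tag (M o)) : O2 := Tagged (fun o => tag (M o) : Type) i.
pose M' o (t : O2) : op R (sys G) :=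
  (fun x y => \sum_(i | inj o i == t) tagged (M o) i x y)%R.
have MM' o : in_M mc (M' o) by apply: in_M_coarse; have [] := MP o.
apply: le_trans (msup_chain iF pr ps MM' pq).
rewrite -[X in X <= _]add0e; apply: leeD; first exact: (relent_inst_ge0 iF).
rewrite big_filter; apply: lee_sum => o po.
rewrite (MP o).2 // /M' !meas_coarse relent_inj //.
by move=> i j /eqP; rewrite eq_Tagged /= => /eqP.
Qed.

Lemma MER_superadditive mc pc (H1 H2 : 'I_n -> finType)
    (rho : op R (sys (jointH H1 H2))) : is_state rho ->
  MER mc pc (redX rho) + MER mc pc (redY rho) <= MER mc pc rho.
Proof.
move=> [pr tr1]; apply: le_MER => sigma /in_P_cone[Ps ts1].
have ps := Pcone_psd Ps.
have sX (t : op R (sys (jointH H1 H2))) : psd t -> tr t = 1%R ->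
    is_state (redX t : op R (sys H1)).
  by move=> pt tt; split; [exact: (sepmap_psd (@sepmap_redX R n H1 H2) pt)|rewrite tr_redX].
have PX : in_P pc (redX sigma : op R (sys H1)).
  by apply/in_P_cone; split; [exact: (Pcone_sepmap (@sepmap_redX R n H1 H2) Ps)|rewrite tr_redX].
have key (O : finType) (M : O -> op R (sys H1)) : in_M mc M ->
    MER mc pc (redY rho) + relent (meas M (redX rho)) (meas M (redX sigma))
      <= msup mc rho sigma.
  move=> MM; have iF := @inst_cond_map R n mc H1 H2 O M MM.
  have pM := in_M_povm MM.
  pose F o := @cond_map R n H1 H2 (M o).
  pose p o := complex.Re (tr (F o rho)); pose q o := complex.Re (tr (F o sigma)).
  have [[a pa qa]|pq] := inst_prob_posP rho iF ps.
    by rewrite (msup_chain_infty iF pr ps pa qa) leey.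
  have p0 o : (0 <= p o)%R := inst_prob_ge0 iF o pr.
  have q0 o : (0 <= q o)%R := inst_prob_ge0 iF o ps.
  have pE : meas M (redX rho) = p by apply/funext => o; rewrite /p /F tr_cond_map.
  have qE : meas M (redX sigma) = q by apply/funext => o; rewrite /q /F tr_cond_map.
  rewrite pE qE.
  (* The conditional states of [sigma] are mixed with the probabilities of [rho], so that both
     arguments carry the same weights for joint convexity. If [q o = 0] then [p o = 0], and the term
     drops out. *)
  pose s : op R (sys H2) := (fun x y =>
    \sum_o scale_op (p o) (scale_op (q o)^-1 (F o sigma)) x y)%R.
  have Pss : in_P pc s.
    apply/in_P_cone; split.
      rewrite (_ : s = \sum_o scale_op (p o) (scale_op (q o)^-1 (F o sigma)))%R.
        apply: Pcone_sum => o _; apply: Pcone_scale => //.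
        apply: Pcone_scale; first by rewrite invr_ge0.
        by apply: Pcone_sepmap Ps; have [sF _] := inst_sepinst iF; exact: sF.
      by apply/funext => x; apply/funext => y; rewrite !fct_sumE.
    rewrite /tr /s exchange_big /=.
    transitivity ((\sum_o p o)%:C)%C; last first.
      by rewrite (inst_prob_sum iF) tr1.
    rewrite rmorph_sum; apply: eq_bigr => o _; rewrite -/(tr _) tr_scale.
    have := p0 o; rewrite le_eqVlt => /orP[/eqP <-|po]; first by rewrite mul0r.
    by rewrite (is_state_inst iF ps (pq o po)).2 mulr1.
  have rE : redY rho = (fun x y => \sum_o scale_op (p o) (scale_op (p o)^-1 (F o rho)) x y)%R.
    rewrite -(sum_cond_map rho pM); apply/funext => x; apply/funext => y.
    apply: eq_bigr => o _; rewrite /scale_op mulrA -rmorphM.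
    have := p0 o; rewrite le_eqVlt => /orP[/eqP po|po]; last first.
      by rewrite mulfV ?gt_eqF // mul1r.
    have pF : psd (F o rho).
      by apply: sepmap_psd pr; have [sF _] := inst_sepinst iF; exact: sF.
    rewrite -/(F o) (psd_tr0 pF) ?mulr0 //.
    by rewrite -(ge0_ReK (tr_ge0 pF)) -/(p o) -po.
  apply: (@le_trans _ _ (relent p q + msup mc (redY rho) s)).
    by rewrite addeC; apply: leeD => //; exact: MER_le.
  rewrite -[X in _ + X]mul1e; apply: adde_mul_sup_le.
  - exact: ltr01.
  - exact: (relent_inst_ge0 iF).
  - by eexists; exists _, (@icpovm R n H2); split; [exact: in_M_icpovm|].
  - move=> _ [ O2 [N [NM ->]]]; apply: meas_relent_ge0 (in_M_povm NM) _ (in_P_state Pss).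
    split; last by rewrite tr_redY.
    rewrite rE (_ : (fun x y => _) = \sum_o scale_op (p o) (scale_op (p o)^-1 (F o rho)))%R.
      apply: psd_sum => o _; do 2 (apply: psd_scale; first by rewrite ler0c ?invr_ge0).
      by apply: sepmap_psd pr; have [sF _] := inst_sepinst iF; exact: sF.
    by apply/funext => x; apply/funext => y; rewrite !fct_sumE.
  move=> _ [ O2 [N [NM ->]]]; rewrite mul1e.
  apply: le_trans (msup_chain iF pr ps (fun=> NM) pq).
  apply: leeD => //.
  have -> : meas N (redY rho) = (fun i =>
      \sum_o p o * meas N (scale_op (p o)^-1 (F o rho)) i)%R.
    by apply/funext => i; rewrite rE meas_sum; apply: eq_bigr => o _; rewrite meas_scale.
  have -> : meas N s = (fun i =>
      \sum_o p o * meas N (scale_op (q o)^-1 (F o sigma)) i)%R.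
    by apply/funext => i; rewrite meas_sum; apply: eq_bigr => o _; rewrite meas_scale.
  apply: le_trans (relent_convex _ _ _) _ => //.
  - move=> o i; rewrite meas_scale mulr_ge0 ?invr_ge0 //.
    apply: meas_ge0 (in_M_povm NM) _.
    by apply: sepmap_psd pr; have [sF _] := inst_sepinst iF; exact: sF.
  - move=> o i; rewrite meas_scale mulr_ge0 ?invr_ge0 //.
    apply: meas_ge0 (in_M_povm NM) _.
    by apply: sepmap_psd ps; have [sF _] := inst_sepinst iF; exact: sF.
  rewrite (bigID (fun o => 0 < p o)%R) /= [X in _ + X <= _]big1 ?adde0 // => o po.
  have -> : p o = 0%R by apply: le_anti; rewrite p0 andbT leNgt.
  by rewrite mul0e.
(* The state [s] inside [key] varies with [M], but [MER mc pc (redY rho)] does not; the supremum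
   over [M] can thus be taken with this summand fixed. *)
apply: (@le_trans _ _ (MER mc pc (redY rho) + msup mc (redX rho) (redX sigma))).
  by rewrite addeC; apply: leeD => //; exact: MER_le.
rewrite -[X in _ + X]mul1e; apply: adde_mul_sup_le.
- exact: ltr01.
- apply: MER_ge0; split; last by rewrite tr_redY.
  have iF := @inst_cond_map R n mc H1 H2 _ _ (in_M_icpovm R mc H1).
  rewrite -(sum_cond_map rho (in_M_povm (in_M_icpovm R mc H1))).
  rewrite (_ : (fun x y => _) = \sum_o cond_map (icpovm R o) rho)%R.
    by apply: psd_sum => o _; apply: sepmap_psd pr; have [sF _] := inst_sepinst iF; exact: sF.
  by apply/funext => x; apply/funext => y; rewrite !fct_sumE.
- by eexists; exists _, (@icpovm R n H1); split; [exact: in_M_icpovm|].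
- move=> _ [ O2 [N [NM ->]]]; apply: meas_relent_ge0 (in_M_povm NM) _ (in_P_state PX).
  exact: sX.
by move=> _ [ O2 [N [NM ->]]]; rewrite mul1e; exact: key.
Qed.
End Monotone.

Theorem theorem2 (R : realType) (mc : mclass) (pc : pclass) :
  (* (a) faithfulness *)
  (forall (n : nat) (H : 'I_n -> finType) (rho : op R (sys H)),
     is_state rho -> (MER mc pc rho = 0%E <-> in_P pc rho))
  /\
  (* (b) convexity *)
  (forall (n : nat) (H : 'I_n -> finType) (m : nat) (p : 'I_m -> R)
          (rhos : 'I_m -> op R (sys H)),
     (forall i, 0 <= p i) -> \sum_(i < m) p i = 1 ->
     (forall i, is_state (rhos i)) ->
     (MER mc pc (fun x y => (\sum_(i < m) ((p i)%:C)%C * rhos i x y)%R)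
        <= \sum_(i < m) ((p i)%:E * MER mc pc (rhos i)))%E)
  /\
  (* (c) strong LOCC monotonicity *)
  (forall (n : nat) (H H' : 'I_n -> finType) (O : finType)
          (E : O -> cmap R (sys H) (sys H')),
     LOCC E -> forall rho_in : op R (sys H), is_state rho_in ->
     let p_out := fun o => complex.Re (tr (E o rho_in)) in
     let rho_out := fun o => (fun x y => ((((p_out o)^-1)%:C)%C * E o rho_in x y)%R)
                             : op R (sys H') in
     (\sum_(o : O | (0 < p_out o)%R) ((p_out o)%:E * MER mc pc (rho_out o))
        <= MER mc pc rho_in)%E)
  /\
  (* (d) strong superadditivity *)
  (forall (n : nat) (H1 H2 : 'I_n -> finType)
          (rho : op R (sys (jointH H1 H2))),
     is_state rho ->
     (MER mc pc (redX rho) + MER mc pc (redY rho) <= MER mc pc rho)%E).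
Proof.
split; first by move=> n H rho sr; split; [exact: MER_eq0|exact: MER_in_P].
split; first by move=> n H m p rhos; exact: MER_convex.
split; last by move=> n H1 H2 rho; exact: MER_superadditive.
move=> n H H' O E lE rho sr; apply: MER_inst sr; case: mc => //; exact: LOCC_sepinst.
Qed.
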